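(* Let $p \ge 2$ and $n \ge 6p-3$ be integers. Then the $3$-cut complex $\Delta_3(C_n^p)$ is shellable. Moreover, $$\Delta_3(C_n^p) \simeq \bigvee_{\binom{n-2p}{2}-(2p^2+p-1)} \mathbb{S}^{n-4},$$ that is, $\Delta_3(C_n^p)$ is homotopy equivalent to a wedge of $\binom{n-2p}{2}-(2p^2+p-1)$ spheres of dimension $n-4$.
   Context: For $n\ge 3$, $C_n$ is the cycle graph on vertex set $\{0,1,\dots,n-1\}$. For a graph $G$ and positive integer $p$, the $p$-th power $G^p$ has the same vertex set as $G$, with $u,v$ adjacent iff there is a path of length at most $p$ between them in $G$; thus in $C_n^p$, $u$ and $v$ are adjacent iff $v \equiv u \pm j \pmod n$ for some $j\in\{1,\dots,p\}$. For a graph $G$ and $k\ge1$, the $k$-cut complex $\Delta_k(G)$ is the simplicial complex on $V(G)$ whose facets are the subsets $\sigma\subseteq V(G)$ with $|\sigma| = |V(G)|-k$ such that the induced subgraph $G[V(G)\setminus\sigma]$ is disconnected. A simplicial complex is shellable if its facets can be linearly ordered $F_1,\dots,F_j$ so that for each $2\le s\le j$ the subcomplex $\left(\bigcup_{r<s}\overline{F_r}\right)\cap \overline{F_s}$ is pure of dimension $\dim F_s - 1$ (where $\overline{F}$ denotes the simplex $F$ with all its faces). *)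

(* Defs.v *)
From HB Require Import structures.
From mathcomp Require Import all_boot all_order all_algebra.

Set Implicit Arguments.
Unset Strict Implicit.
Unset Printing Implicit Defensive.

Import Order.TTheory GRing.Theory Num.Theory.

(* A (simple) graph on a finite vertex set is given by its adjacency relation. *)

Definition cycle_graph (n : nat) : rel 'I_n :=
  [rel u v | (ordS u == v) || (ordS v == u)].
Arguments cycle_graph n : clear implicits.

(* [u :: s] runs over the paths (no repeated vertex) from u; its length is
   the number of edges, i.e., the size of s. *)
Definition graph_power (T : finType) (e : rel T) (p : nat) : rel T :=
  [rel u v | (u != v) &&
    [exists l : 'I_p.+1, exists s : l.-tuple T,
      [&& path e u s, uniq (u :: s) & last u s == v]]].

Definition induced (T : finType) (e : rel T) (S : {set T}) : rel T :=
  [rel u v | [&& u \in S, v \in S & e u v]].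

Definition induced_connected (T : finType) (e : rel T) (S : {set T}) : bool :=
  [forall u in S, forall v in S, connect (induced e S) u v].

(* A simplicial complex on a finite vertex set T is given by its set of faces,
   a family of type {set {set T}} closed under taking subsets (including the
   empty face, of dimension -1). *)

Section Complexes.
Variable T : finType.
Implicit Types (K F : {set {set T}}) (s : {set T}).

Definition generated_complex F : {set {set T}} :=
  \bigcup_(s in F) powerset s.

Definition facets K : {set {set T}} :=
  [set s in K | [forall t in K, (s \subset t) ==> (t == s)]].

Definition face_dim s : int := (Posz #|s| - 1)%R.

Definition pure_of_dim K (d : int) : Prop :=
  forall s, s \in facets K -> face_dim s = d.

(* For a shelling sh = [:: F_1; ...; F_j], nth set0 sh i is F_(i+1). *)
Definition shelling (sh : seq {set T}) : Prop :=
  forall i, (0 < i < size sh)%N ->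
    pure_of_dim
      ((\bigcup_(s <- take i sh) powerset s) :&: powerset (nth set0 sh i))
      (face_dim (nth set0 sh i) - 1)%R.

Definition shellable K : Prop :=
  exists sh : seq {set T}, perm_eq sh (enum (facets K)) /\ shelling sh.

Definition cut_complex (e : rel T) (k : nat) : {set {set T}} :=
  generated_complex
    [set s : {set T} |
      (#|s| + k == #|T|)%N && ~~ induced_connected e (~: s)].

End Complexes.

From mathcomp Require Import all_classical all_reals all_analysis.
From mathcomp Require Import wedge_sigT.

Import numFieldNormedType.Exports.

Section Topology.
Local Open Scope classical_set_scope.
Local Open Scope ring_scope.
Variable R : realType.

(* Barycentric coordinates in R^n, with the topology induced from R^n. *)
Definition geometric_realization (n : nat) (K : {set {set 'I_n}}) :
    topologicalType :=
  set_type [set x : 'rV[R]_n |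
    [/\ forall i, 0 <= x ord0 i, \sum_i x ord0 i = 1
      & finset (fun i => x ord0 i != 0) \in K]].

(* The library norm on 'rV[R]_n is the sup norm, so the Euclidean norm is
   spelled out. *)
Definition sphere_set (d : nat) : set 'rV[R]_d.+1 :=
  [set x | \sum_i x ord0 i ^+ 2 = 1].
Arguments sphere_set d : clear implicits.

Definition sphere (d : nat) : topologicalType := set_type (sphere_set d).

Lemma sphere_base_subproof (d : nat) :
  (delta_mx ord0 ord0 : 'rV[R]_d.+1) \in sphere_set d.
Proof.
apply/mem_set; rewrite /sphere_set /= (bigD1 ord0) //= big1 => [|i i0].
  by rewrite mxE !eqxx expr1n addr0.
by rewrite mxE (negbTE i0) andbF expr0n.
Qed.

Definition sphere_base (d : nat) : sphere d :=
  exist _ (delta_mx ord0 ord0) (sphere_base_subproof d).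

(* For m = 0 this is the empty space, not a point. *)
Definition wedge_of_spheres (m d : nat) : topologicalType :=
  wedge (fun _ : 'I_m => sphere_base d).

Definition homotopic (X Y : topologicalType) (f g : X -> Y) : Prop :=
  exists H : R * X -> Y,
    [/\ {within (`[0, 1] : set R) `*` [set: X], continuous H},
        forall x, H (0, x) = f x
      & forall x, H (1, x) = g x].

Definition homotopy_equivalent (X Y : topologicalType) : Prop :=
  exists (f : X -> Y) (g : Y -> X),
    [/\ continuous f, continuous g,
        homotopic (g \o f) id & homotopic (f \o g) id].

End Topology.

Arguments sphere_set R d : clear implicits.

(* Main.v *)
From mathcomp Require Import all_boot all_order all_algebra.
From mathcomp Require Import all_classical all_reals all_analysis.
From mathcomp Require Import wedge_sigT ring lra zify.
Require Import Defs.

(* A facet of the 3-cut complex is the complement of a triple a < b < c cutting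
   the cycle into three arcs, at least two of them longer than p. Order the
   triples by increasing a, then decreasing b, then increasing c, except that the
   triples with c + p - n < a <= b + 2p - n and b >= n - p are moved to the end.
   An exchange argument in linear arithmetic shows that this is a shelling, and
   that a facet is glued along its whole boundary exactly when b = a + 1,
   a + 2p < c and (2p - 1 <= a or c + 2p < a + n); these are counted by the
   formula.

   The facets that are not glued along their whole boundary form a subcomplex A,
   and the shelling contracts |A|: a new facet F whose minimal new face is S
   retracts onto the earlier ones by decreasing the coordinates of S at equal
   speed. Pushing the remaining cells outwards extends the contraction to a
   homotopy of |K| preserving |A|. It descends along the map collapsing A to a
   point, whose target is the wedge of spheres, and the collapse map is therefore
   a homotopy equivalence. *)

Set Implicit Arguments.
Unset Strict Implicit.
Unset Printing Implicit Defensive.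
Import Order.TTheory GRing.Theory Num.Theory.
Import numFieldNormedType.Exports.
Local Open Scope classical_set_scope.
Local Open Scope ring_scope.

(** * Homotopies descending to a quotient *)

(** The late triples are forced. Let [(a, b, c)] be late and [v = b + p - n]. Then [v < a], and [v]
    is within distance [p] of [a], of [b] and of [c], so no cut triple consists of [v] and two of
    them. Without the exception, [(a, b, c)] would come after some cut triple [(v, x, y)] with
    [a < x < y < b]; trading [x] or [y] into [(a, b, c)] gives triples that start later, or that
    keep [a] and have a smaller middle vertex, and all of these would come later as well. No
    exchange would exist. The trade becomes available once late triples stand at the end and their
    middle vertices increase. The same [v] shows that a late facet is never glued along its whole
    boundary. *)

Lemma hausdorff_prod (X Y : topologicalType) :
  hausdorff_space X -> hausdorff_space Y -> hausdorff_space (X * Y)%type.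
Proof.
move=> hX hY [x1 y1] [x2 y2] cl.
have -> : x1 = x2.
  apply: hX => U V Ux Vx.
  have [|| [a b] [/= Ua Va]] := cl (U `*` setT) (V `*` setT).
  - by exists (U, setT) => //; split => //; exact: filterT.
  - by exists (V, setT) => //; split => //; exact: filterT.
  by exists a; case: Ua => /= + _; case: Va.
have -> // : y1 = y2.
apply: hY => U V Ux Vx.
have [|| [a b] [/= Ua Va]] := cl (setT `*` U) (setT `*` V).
- by exists (setT, U) => //; split => //; exact: filterT.
- by exists (setT, V) => //; split => //; exact: filterT.
by exists b; case: Ua => /= _ ?; case: Va.
Qed.

Lemma continuous_pair (T X Y : topologicalType) (f : T -> X) (g : T -> Y) :
  continuous f -> continuous g -> continuous (fun t => (f t, g t)).
Proof. by move=> cf cg x; apply: cvg_pair; [exact: cf|exact: cg]. Qed.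

Lemma continuous_fst (X Y : topologicalType) : continuous (@fst X Y).
Proof. by move=> x; exact: cvg_fst. Qed.

Lemma continuous_snd (X Y : topologicalType) : continuous (@snd X Y).
Proof. by move=> x; exact: cvg_snd. Qed.

Lemma continuous_compose (X Y Z : topologicalType) (f : X -> Y) (g : Y -> Z) :
  continuous f -> continuous g -> continuous (fun x => g (f x)).
Proof. by move=> cf cg x; apply: (@continuous_comp _ _ _ f g); [exact: cf|exact: cg]. Qed.

Lemma closed_map_compact (X Y : topologicalType) (f : X -> Y) (K C : set X) :
  hausdorff_space Y -> continuous f -> compact K -> closed C -> C `<=` K ->
  closed (f @` C).
Proof.
move=> hY cf cK cC CK; apply: compact_closed => //.
apply: continuous_compact; first exact: continuous_subspaceT.
exact: subclosed_compact cK CK.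
Qed.

(* By compactness f is a closed map, hence a quotient map, and so is its product
   with the identity of [0, 1]. *)
Lemma quotient_homotopy_equivalent (R : realType) (X Y : topologicalType)
    (f : X -> Y) (H : R * X -> X) :
  compact [set: X] -> hausdorff_space Y -> continuous f ->
  (forall y, exists x, f x = y) -> continuous H ->
  (forall x, H (0, x) = x) ->
  (forall t x x', 0 <= t <= 1 -> f x = f x' -> f (H (t, x)) = f (H (t, x'))) ->
  (forall x x', f x = f x' -> H (1, x) = H (1, x')) ->
  homotopy_equivalent R X Y.
Proof.
move=> cX hY cf /choice[s sK] cH H0 Hf H1.
have crev (Z : topologicalType) : continuous (fun z : R * Z => (1 - z.1, z.2)).
  apply: continuous_pair; last exact: continuous_snd.
  move=> z; apply: continuousB; first exact: cst_continuous.
  exact: continuous_fst.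
(* The section [s] is an arbitrary choice and need not be continuous. [H (1, s y)] does not depend
   on it, by [H1], and this is what makes the inverse continuous. Time is reversed because [H]
   starts at the identity, where [homotopic] must end. *)
exists f, (fun y => H (1, s y)); split => //.
- apply/continuous_closedP => C cC.
  have -> : (fun y => H (1, s y)) @^-1` C = f @` ((fun x => H (1, x)) @^-1` C).
    apply/seteqP; split=> [y /= Cy|_ [x /= Cx <-]]; first by exists (s y).
    by rewrite /= (@H1 _ x).
  apply: (closed_map_compact hY cf cX) => //.
  move: C cC; apply/continuous_closedP.
  apply: (@continuous_compose _ _ _ (fun x : X => (1 : R, x)) H) => //.
  apply: continuous_pair; first exact: cst_continuous.
  by move=> x; exact: cvg_id.
- exists (fun z => H (1 - z.1, z.2)); split.
  + apply: continuous_subspaceT; exact: continuous_compose (crev X) cH.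
  + by move=> x /=; rewrite subr0 (@H1 x (s (f x))) // sK.
  + by move=> x /=; rewrite subrr.
- exists (fun z => f (H (1 - z.1, s z.2))); split; last 2 first.
  + by move=> x /=; rewrite subr0.
  + by move=> x /=; rewrite subrr H0 sK.
  pose I01 : set R := `[0, 1]%classic.
  have cI : closed I01 by exact: itv_closed.
  apply/continuous_closedP => C cC; apply/closed_subspaceP.
  pose D : set (R * X) := (I01 `*` setT) `&`
     (fun z => f (H (1 - z.1, z.2))) @^-1` C.
  pose g (z : R * X) := (z.1, f z.2).
  have cg : continuous g.
    apply: continuous_pair; first exact: continuous_fst.
    exact: continuous_compose (@continuous_snd _ _) cf.
  have cD : closed D.
    apply: closedI.
      have -> : I01 `*` [set: X] = fst @^-1` I01.
        by apply/seteqP; split => [[a b] []|[a b]].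
      by have /continuous_closedP := @continuous_fst R X; exact.
    have /continuous_closedP := continuous_compose
      (continuous_compose (crev X) cH) cf; exact.
  exists (g @` D).
    apply: (@closed_map_compact _ _ g (I01 `*` setT)) => //; last by move=> z [].
      apply: hausdorff_prod => //; exact: Rhausdorff.
    by apply: compact_setX => //; exact: segment_compact.
  apply/seteqP; split => [_ [[[t x] /= [[It _] Cx] <-] [_ _]]|[t y] [/= Cy [It _]]].
    split; last by split.
    change (C (f (H (1 - t, s (f x))))); rewrite (@Hf _ (s (f x)) x) //.
    by move: It; rewrite /I01 /= in_itv /= => /andP[? ?]; apply/andP; split; lra.
  split; last by split.
  by exists (t, s y); rewrite /g /= ?sK.
Qed.

(** * Realizations and their contractions *)

Section ContinuityRules.
Variables (R : realType) (T : topologicalType).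
Implicit Types f g : T -> R.

Lemma continuous_addf f g :
  continuous f -> continuous g -> continuous (fun x => f x + g x).
Proof. by move=> cf cg x; apply: (@continuousD _ _ _ f g); [exact: cf|exact: cg]. Qed.

Lemma continuous_oppf f : continuous f -> continuous (fun x => - f x).
Proof. by move=> cf x; apply: (@continuousN _ _ _ f); exact: cf. Qed.

Lemma continuous_mulf f g :
  continuous f -> continuous g -> continuous (fun x => f x * g x).
Proof. by move=> cf cg x; apply: (@continuousM _ _ f g); [exact: cf|exact: cg]. Qed.

Lemma continuous_divf f g : continuous f -> continuous g ->
  (forall x, g x != 0) -> continuous (fun x => f x / g x).
Proof.
move=> cf cg g0; apply: continuous_mulf => // x.
by apply: continuousV; [exact: g0|exact: cg].
Qed.

Lemma continuous_minf f g :
  continuous f -> continuous g -> continuous (fun x => Num.min (f x) (g x)).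
Proof. by move=> cf cg x; apply: (@continuous_min _ _ f g); [exact: cf|exact: cg]. Qed.

Lemma continuous_maxf f g :
  continuous f -> continuous g -> continuous (fun x => Num.max (f x) (g x)).
Proof. by move=> cf cg x; apply: (@continuous_max _ _ f g); [exact: cf|exact: cg]. Qed.

Lemma continuous_sumf (I : Type) (r : seq I) (P : pred I) (F : I -> T -> R) :
  (forall i, P i -> continuous (F i)) ->
  continuous (fun x => \sum_(i <- r | P i) F i x).
Proof. by move=> cF; apply: continuous_big => // x; exact: add_continuous. Qed.

Lemma continuous_bigminf (I : Type) (r : seq I) (P : pred I) (F : I -> T -> R) :
  (forall i, P i -> continuous (F i)) ->
  continuous (fun x => \big[Num.min/1]_(i <- r | P i) F i x).
Proof.
move=> cF; apply: continuous_big => // x.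
by apply: (@continuous_min _ _ (@fst R R) (@snd R R)); [exact: cvg_fst|exact: cvg_snd].
Qed.

Lemma continuous_coordf n (f : T -> 'rV[R]_n) i :
  continuous f -> continuous (fun x => f x ord0 i).
Proof. move=> cf x; apply: (@continuous_comp _ _ _ f (fun v : 'rV[R]_n => v ord0 i)).
  exact: cf.
exact: coord_continuous. Qed.

Lemma continuous_rowf n (f : T -> 'rV[R]_n) :
  (forall i, continuous (fun x => f x ord0 i)) -> continuous f.
Proof.
move=> cf x A [E xE EA]; 
suff: \forall y \near x, forall j, E ord0 j (f y ord0 j).
  by apply: filterS => y Ey; apply: EA => i j; rewrite ord1; exact: Ey.
by apply: filter_forall => j; exact: (cf j x _ (xE ord0 j)).
Qed.

Lemma continuous_row n (f : 'I_n -> T -> R) :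
  (forall i, continuous (f i)) -> continuous (fun x => \row_i f i x).
Proof.
move=> cf; apply: continuous_rowf => i.
have -> : (fun x => (\row_j f j x) ord0 i) = f i by apply/funext => x; rewrite mxE.
exact: cf.
Qed.

End ContinuityRules.

Lemma continuous_constf (T U : topologicalType) (c : U) : continuous (fun _ : T => c).
Proof. exact: cst_continuous. Qed.

Lemma continuous_idf (T : topologicalType) : continuous (fun x : T => x).
Proof. by move=> x; exact: cvg_id. Qed.

(* [continuous] is a notation; the constant makes the goal matchable by head. *)
Definition is_continuous (T U : topologicalType) (f : T -> U) := continuous f.

Lemma is_continuousP (T U : topologicalType) (f : T -> U) :
  is_continuous f -> continuous f.
Proof. by []. Qed.

Ltac cont := try apply: is_continuousP;
  lazymatch goal with
  | |- is_continuous (fun _ => ?c) => exact: continuous_constf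
  | |- is_continuous (fun x => x) => exact: continuous_idf
  | |- is_continuous fst => exact: continuous_fst
  | |- is_continuous snd => exact: continuous_snd
  | |- is_continuous (fun x => x.1) => exact: continuous_fst
  | |- is_continuous (fun x => x.2) => exact: continuous_snd
  | |- is_continuous (fun x => @?f x + @?g x) =>
      apply: (@continuous_addf _ _ f g); cont
  | |- is_continuous (fun x => - @?f x) => apply: (@continuous_oppf _ _ f); cont
  | |- is_continuous (fun x => @?f x * @?g x) =>
      apply: (@continuous_mulf _ _ f g); cont
  | |- is_continuous (fun x => Num.min (@?f x) (@?g x)) =>
      apply: (@continuous_minf _ _ f g); cont
  | |- is_continuous (fun x => Num.max (@?f x) (@?g x)) =>
      apply: (@continuous_maxf _ _ f g); cont
  | |- is_continuous (fun x => fun_of_matrix (@?f x) _ ?i) =>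
      apply: (@continuous_coordf _ _ _ f i); cont
  | |- is_continuous (fun x => (@?f x, @?g x)) =>
      apply: (@continuous_pair _ _ _ f g); cont
  | |- is_continuous (fun x => \sum_(i <- ?r | @?P i) @?F x i) =>
      refine (@continuous_sumf _ _ _ r P (fun i x => F x i) _); move=> ? _; cont
  | _ => rewrite /is_continuous; try by []
  end.

Lemma continuous_to_set_type (T U : topologicalType) (A : set U) (f : T -> set_type A) :
  continuous (fun x => set_val (f x)) -> continuous f.
Proof. by move=> cf; exact: continuous_comp_initial. Qed.

Lemma continuous_set_val (U : topologicalType) (A : set U) :
  continuous (fun x : set_type A => set_val x).
Proof. exact: initial_continuous. Qed.

Section Realization.
Variables (R : realType) (n : nat).
Local Notation V := 'rV[R]_n.
Implicit Types (K : {set {set 'I_n}}) (F G S : {set 'I_n}) (x : V) (t : R).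

Definition supp x : {set 'I_n} := finset (fun i => x ord0 i != 0).

Definition realization K : set V :=
  [set x : V | [/\ forall i, 0 <= x ord0 i, \sum_i x ord0 i = 1 & supp x \in K]].

Definition down_closed K := forall F G, F \in K -> G \subset F -> G \in K.

Lemma in_supp x i : (i \in supp x) = (x ord0 i != 0).
Proof. by rewrite inE. Qed.

Lemma coord_notin_supp x i F : supp x \subset F -> i \notin F -> x ord0 i = 0.
Proof.
move=> /fintype.subsetP sF iF; apply/eqP/negPn/negP => xi.
by move/negP: iF; apply; apply: sF; rewrite in_supp.
Qed.

Lemma realizationE K x F : down_closed K -> F \in K ->
  (forall i, 0 <= x ord0 i) -> \sum_i x ord0 i = 1 ->
  (forall i, i \notin F -> x ord0 i = 0) -> realization K x.
Proof.
move=> dK FK x0 x1 xF; split => //; apply: dK FK _; apply/fintype.subsetP => i.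
by rewrite in_supp; apply: contraNT => /xF ->.
Qed.

Lemma realization_le1 K x i : realization K x -> x ord0 i <= 1.
Proof.
case=> x0 <- _; rewrite (bigD1 i) //= lerDl; exact: sumr_ge0.
Qed.

Lemma sum_supp x F : supp x \subset F -> \sum_(i in F) x ord0 i = \sum_i x ord0 i.
Proof.
move=> sF; rewrite [RHS](bigID (mem F)) /= [X in _ + X]big1 ?addr0 //.
by move=> i; exact: coord_notin_supp.
Qed.

(** On points with nonnegative coordinates it is positive exactly on the open star of [S], and so
    marks it continuously. No coordinate of a realization exceeds the neutral value 1, which is
    therefore harmless for nonempty [S]. *)
Definition min_coord S x : R := \big[Num.min/1]_(i in S) x ord0 i.

Lemma min_coord_le S x i : i \in S -> min_coord S x <= x ord0 i.
Proof. by move=> iS; exact: bigmin_le_cond. Qed.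

Lemma min_coord_ge0 S x : (forall i, 0 <= x ord0 i) -> 0 <= min_coord S x.
Proof. by move=> x0; apply/bigmin_geP; split. Qed.

Lemma min_coord_gt0 S x : (forall i, 0 <= x ord0 i) ->
  (0 < min_coord S x) = (S \subset supp x).
Proof.
move=> x0; apply/idP/fintype.subsetP => [/bigmin_gtP[_ xS] i /xS|sS].
  by rewrite in_supp lt0r => /andP[].
by apply/bigmin_gtP; split => // i /sS; rewrite in_supp lt0r x0 andbT.
Qed.

Lemma min_coord_eq0 S x : (forall i, 0 <= x ord0 i) -> ~~ (S \subset supp x) ->
  min_coord S x = 0.
Proof.
move=> x0; rewrite -min_coord_gt0 // -leNgt => m0.
by apply/le_anti; rewrite m0 min_coord_ge0.
Qed.

Lemma min_coord_attained S x j : j \in S -> (forall i, x ord0 i <= 1) ->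
  exists2 i, i \in S & min_coord S x = x ord0 i.
Proof.
move=> jS x1; have [i iS E] := @eq_bigmin _ _ _ 1 j (mem S) (x ord0) jS (fun i _ => x1 i).
by exists i; first by rewrite inE in iS.
Qed.

Lemma continuous_min_coord (T : topologicalType) (f : T -> V) S :
  continuous f -> continuous (fun y => min_coord S (f y)).
Proof. by move=> cf; apply: continuous_bigminf => i _; exact: continuous_coordf. Qed.

Lemma realization_compact K : down_closed K -> compact (realization K).
Proof.
move=> dK; apply: bounded_closed_compact.
  exists 1; split; first exact: num_real.
  move=> M M1 x xK /=; rewrite /Num.norm /= mx_normrE.
  apply/bigmax_leP; split => [|[i j] _ /=]; first by lra.
  have [x0 _ _] := xK; rewrite (ord1 i) ger0_norm //.
  exact: le_trans (realization_le1 j xK) (ltW M1).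
(* The condition on [supp] is not visibly closed. Since [K] is closed under subsets, it becomes a
   finite union of closed conditions: vanishing outside some face. *)
have -> : realization K =
  (\bigcap_i [set x : V | 0 <= x ord0 i]) `&` [set x : V | \sum_i x ord0 i = 1] `&`
  (\bigcup_(F in [set F | F \in K]) \bigcap_(i in [set i | i \notin F]) [set x : V | x ord0 i = 0]).
  apply/seteqP; split => [x [x0 x1 xK]|x [[x0 x1] [F FK xF]]].
    split; first by split => // i _; exact: x0.
    exists (supp x) => // i /= iF; exact: coord_notin_supp iF.
  by apply: realizationE FK _ _ _ => // i; exact: x0.
have ci i : continuous (fun x : V => x ord0 i) by exact: coord_continuous.
apply: closedI; first apply: closedI.
- apply: closed_bigI => i _.
  by apply: (@closed_comp _ _ (fun x : V => x ord0 i) [set y | 0 <= y]);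
    [move=> x _; exact: ci|exact: closed_ge].
- apply: (@closed_comp _ _ (fun x : V => \sum_i x ord0 i) [set y | y = 1]).
    by move=> x _; apply: continuous_sumf => i _.
  exact: closed_eq.
- apply: closed_bigcup => [|F _]; first exact: finite_finset.
  apply: closed_bigI => i _.
  by apply: (@closed_comp _ _ (fun x : V => x ord0 i) [set y | y = 0]);
    [move=> x _; exact: ci|exact: closed_eq].
Qed.

End Realization.

Section Contraction.
Variables (R : realType) (n : nat).
Local Notation V := 'rV[R]_n.
Implicit Types (K : {set {set 'I_n}}) (F G S : {set 'I_n}) (x : V) (t : R).

(* The homotopy is defined on the whole ambient space, so that composites of
   such homotopies need no gluing argument. *)
Definition ambient_contraction K (h : R * V -> V) (v : V) : Prop :=
  [/\ continuous h, forall x, h (0, x) = x,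
      forall t x, 0 <= t <= 1 -> realization K x -> realization K (h (t, x)),
      realization K v & forall x, realization K x -> h (1, x) = v].

Lemma sum_indicator S : \sum_i (i \in S)%:R = #|S|%:R :> R.
Proof.
rewrite -sum1_card natr_sum [RHS]big_mkcond; apply: eq_bigr => i _.
by case: (i \in S).
Qed.

Lemma sum_delta (w : 'I_n) : \sum_i (i == w)%:R = 1 :> R.
Proof. by rewrite (bigD1 w) //= eqxx big1 ?addr0 // => i /negbTE ->. Qed.

Lemma down_closed_powerset F : down_closed (powerset F).
Proof.
by move=> A B; rewrite !inE => AF BA; exact: fintype.subset_trans BA AF.
Qed.

Lemma down_closedU K K' : down_closed K -> down_closed K' -> down_closed (K :|: K')%SET.
Proof.
move=> dK dK' A B; rewrite !finset.in_setU => /orP[AK|AK] BA.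
  by rewrite (dK _ _ AK BA).
by rewrite (dK' _ _ AK BA) orbT.
Qed.

Lemma simplex_contraction F w : w \in F ->
  exists h v, ambient_contraction (powerset F) h v.
Proof.
move=> wF; exists (fun z : R * V => \row_i ((1 - z.1) * z.2 ord0 i + z.1 * (i == w)%:R)).
exists (\row_i (i == w)%:R); split.
- apply: continuous_row => i.
  by cont.
- by move=> x; apply/rowP => i; rewrite mxE /=; ring.
- move=> t x /andP[t0 t1] [x0 x1 xF].
  apply: (@realizationE _ _ _ _ F); first exact: down_closed_powerset.
  + by rewrite inE.
  + by move=> i; rewrite mxE /=; apply: addr_ge0; apply: mulr_ge0 => //; lra.
  + under eq_bigr do rewrite mxE /=.
    by rewrite big_split /= -!mulr_sumr x1 sum_delta; ring.
  + move=> i iF; rewrite mxE /= (coord_notin_supp _ iF); last by rewrite inE in xF.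
    by have -> : i == w = false; [apply: contraNF iF => /eqP ->|rewrite /=; ring].
- apply: (@realizationE _ _ _ _ F); first exact: down_closed_powerset.
  + by rewrite inE.
  + by move=> i; rewrite mxE.
  + by under eq_bigr do rewrite mxE; exact: sum_delta.
  + by move=> i; rewrite mxE; case: eqP => [-> /negP|].
- by move=> x _; apply/rowP => i; rewrite !mxE /=; ring.
Qed.

(* Here S is the minimal new face: the faces of [powerset F] not in K are those
   containing S, and flowing away from S towards w retracts onto K. *)
Lemma attach_contraction K F w :
  down_closed K -> (forall G, G \in K -> exists v, [/\ v \in F, v \notin G & (F :\ v)%SET \in K]) ->
  w \in F -> (F :\ w)%SET \notin K ->
  (exists h v, ambient_contraction K h v) ->
  exists h v, ambient_contraction (K :|: powerset F)%SET h v.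
Proof.
move=> dK att wF wK [h [v0 [ch h0 hK v0K h1]]].
pose S : {set 'I_n} := finset (fun v => (v \in F) && ((F :\ v)%SET \in K)).
have SF : S \subset F by apply/fintype.subsetP => i; rewrite inE => /andP[].
(* If [S] were in [K], [att] would give [v] outside [S] with [F :\ v] in [K], but such a [v] belongs
   to [S] by definition. *)
have SK : S \notin K.
  apply/negP => /att[v [vF vS vK]]; move/negP: vS; apply.
  by rewrite inE vF.
have wS : w \notin S by rewrite inE (negbTE wK) andbF.
have dU : down_closed (K :|: powerset F)%SET.
  by apply: down_closedU => //; exact: down_closed_powerset.
have [v vS] : exists v, v \in S.
  case: v0K => _ _ /att[v [vF _ vK]]; exists v.
  by rewrite inE vF.
(* The total mass is preserved: what the vertices of [S] lose is given to [w], which lies outside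
   [S]. At time 1 a smallest coordinate on [S] has vanished. Off the open star of [S] nothing
   moves. *)
pose r (z : R * V) : V := \row_i (z.2 ord0 i - z.1 * min_coord S z.2 * (i \in S)%:R
   + z.1 * min_coord S z.2 * #|S|%:R * (i == w)%:R).
have cr : continuous r.
  apply: continuous_row => i.
  by cont; apply: continuous_min_coord; exact: continuous_snd.
have r0 x : r (0, x) = x by apply/rowP => i; rewrite mxE /=; ring.
have rS t x : (forall i, 0 <= x ord0 i) -> ~~ (S \subset supp x) -> r (t, x) = x.
  by move=> x0 Sx; apply/rowP => i; rewrite mxE /= min_coord_eq0 //; ring.
have suppF x : realization (K :|: powerset F)%SET x -> S \subset supp x -> supp x \subset F.
  case=> _ _; rewrite finset.in_setU powersetE => /orP[xK|//] Sx.
  by move: SK; rewrite (dK _ _ xK Sx).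
have rpos t x i : 0 <= t <= 1 -> (forall i, 0 <= x ord0 i) -> 0 <= r (t, x) ord0 i.
  move=> /andP[t0 t1] x0; rewrite mxE /=.
  have m0 := min_coord_ge0 S x0.
  apply: addr_ge0; last by rewrite !mulr_ge0.
  have [iS|_] := boolP (i \in S); last by rewrite mulr0 subr0.
  have := min_coord_le x iS; rewrite mulr1 => mi.
  by rewrite subr_ge0 (le_trans _ mi) // ler_piMl.
have rsum t x : \sum_i r (t, x) ord0 i = \sum_i x ord0 i.
  under eq_bigr do rewrite mxE /=.
  by rewrite big_split /= sumrB -!mulr_sumr sum_delta sum_indicator; ring.
have rF t x i : supp x \subset F -> i \notin F -> r (t, x) ord0 i = 0.
  move=> xF iF; rewrite mxE /= (coord_notin_supp xF iF).
  have -> : i \in S = false by apply: contraNF iF; exact: (fintype.subsetP SF).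
  by have -> : i == w = false; [apply: contraNF iF => /eqP ->|rewrite /=; ring].
have rU t x : 0 <= t <= 1 -> realization (K :|: powerset F)%SET x ->
    realization (K :|: powerset F)%SET (r (t, x)).
  move=> t01 xK; have [x0 x1 _] := xK.
  have [Sx|Sx] := boolP (S \subset supp x); last by rewrite rS.
  apply: (@realizationE _ _ _ _ F) => //.
  - by rewrite finset.in_setU powersetE fintype.subxx orbT.
  - by move=> i; exact: rpos.
  - by rewrite rsum.
  - by move=> i; apply: rF; exact: suppF.
have r1 x : realization (K :|: powerset F)%SET x -> realization K (r (1, x)).
  move=> xK; have [x0 x1 xKF] := xK.
  have p1 i : 0 <= r (1, x) ord0 i by apply: rpos => //; rewrite ler01 lexx.
  have [Sx|Sx] := boolP (S \subset supp x).
    have [j jS mj] := min_coord_attained vS (fun i => realization_le1 i xK).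
    apply: (@realizationE _ _ _ _ (F :\ j)%SET) => //; first by move: jS; rewrite inE => /andP[].
      by rewrite rsum.
    move=> i; rewrite in_setD1 negb_and negbK => /orP[/eqP ->|]; last by apply: rF; exact: suppF.
    rewrite mxE /= jS mj.
    by have -> : j == w = false; [apply: contraNF wS => /eqP <-|rewrite /=; ring].
  rewrite rS //; split => //; move: xKF; rewrite finset.in_setU powersetE => /orP[//|xF].
  have /fintype.subsetPn[j jS jx] := Sx.
  move: jS; rewrite inE => /andP[jF]; move/dK; apply.
  by rewrite finset.subsetD1 xF.
(* The concatenation in one formula: [r] runs at double speed and then stops, while [h] waits at
   time 0, where it is the identity. No continuity by cases is needed. *)
exists (fun z : R * V => h (Num.max 0 (2 * z.1 - 1), r (Num.min 1 (2 * z.1), z.2))), v0; split.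
- apply: (@continuous_compose _ _ _ (fun z : R * V =>
    (Num.max 0 (2 * z.1 - 1), r (Num.min 1 (2 * z.1), z.2))) h) => //.
  apply: continuous_pair; first by cont.
  apply: (@continuous_compose _ _ _ (fun z : R * V => (Num.min 1 (2 * z.1), z.2)) r) => //.
  by apply: continuous_pair; cont.
- move=> x /=.
  have -> : Num.max 0 (2 * 0 - 1) = 0 :> R by apply/max_idPl; lra.
  have -> : Num.min 1 (2 * 0) = 0 :> R by rewrite mulr0; apply/min_idPr; lra.
  by rewrite r0 h0.
- move=> t x /andP[t0 t1] xK /=.
  have [t2|t2] := lerP (2 * t) 1.
    have -> : Num.max 0 (2 * t - 1) = 0 :> R by apply/max_idPl; lra.
    by rewrite h0; apply: rU => //; apply/andP; split; lra.
  have := hK (Num.max 0 (2 * t - 1)) _ _ (r1 _ xK).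
  have Em : Num.max 0 (2 * t - 1) = 2 * t - 1 :> R by apply/max_idPr; lra.
  rewrite Em => /(_ _)[]; first by apply/andP; split; lra.
  move=> ? ? ?; split => //.
  by rewrite finset.in_setU; apply/orP; left.
- by case: v0K => ? ? ?; split => //; rewrite finset.in_setU; apply/orP; left.
- move=> x xK /=.
  have -> : Num.max 0 (2 * 1 - 1) = 1 :> R.
    by rewrite (_ : 2 * 1 - 1 = 1); [apply/max_idPr; lra|lra].
  have -> : Num.min 1 (2 * 1) = 1 :> R by apply/min_idPl; lra.
  exact/h1/r1.
Qed.

End Contraction.

(** * Attaching cells to a contractible subcomplex *)

Section Extension.
Variables (R : realType) (n d m : nat).
Local Notation V := 'rV[R]_n.
Implicit Types (F G S : {set 'I_n}) (x : V) (t : R).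
Variables (A K : {set {set 'I_n}}) (Fs : 'I_m -> {set 'I_n}).

Definition attached_cells : Prop :=
  [/\ down_closed A, injective Fs,
      forall i, [/\ #|Fs i| = d.+1, Fs i \notin A & forall v, v \in Fs i -> (Fs i :\ v)%SET \in A]
    & forall G, G \in K = (G \in A) || [exists i, G == Fs i]].

Hypothesis cells : attached_cells.

Let dA : down_closed A. Proof. by case: cells. Qed.
Let injF : injective Fs. Proof. by case: cells. Qed.
Let cardF i : #|Fs i| = d.+1. Proof. by case: cells => _ _ /(_ i)[]. Qed.
Let FA i : Fs i \notin A. Proof. by case: cells => _ _ /(_ i)[]. Qed.
Let bdF i v : v \in Fs i -> (Fs i :\ v)%SET \in A.
Proof. by case: cells => _ _ /(_ i)[_ _ h] _; exact: h. Qed.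
Let KE G : G \in K = (G \in A) || [exists i, G == Fs i].
Proof. by case: cells. Qed.

Lemma cells_subset i x : realization K x -> Fs i \subset supp x -> supp x = Fs i.
Proof.
case=> _ _; rewrite KE => /orP[xA|/existsP[j /eqP ->]] Fx.
  by move: (FA i); rewrite (dA xA Fx).
by apply/esym/eqP; rewrite eqEcard Fx !cardF leqnn.
Qed.

Lemma sub_realization x : realization A x -> realization K x.
Proof. by case=> x0 x1 xA; split => //; rewrite KE xA. Qed.

Lemma cells_face i G : G \subset Fs i -> G != Fs i -> G \in A.
Proof.
move=> GF; rewrite finset.eqEsubset GF /= => /fintype.subsetPn[v vF vG].
by apply: dA (bdF vF) _; rewrite finset.subsetD1 GF.
Qed.

Lemma down_closed_cells : down_closed K.
Proof.
move=> F G; rewrite !KE => /orP[FA'|/existsP[i /eqP ->]] GF.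
  by rewrite (dA FA' GF).
have [->|GFi] := eqVneq G (Fs i); first by apply/orP; right; apply/existsP; exists i.
by rewrite (cells_face GF GFi).
Qed.

Lemma min_coord_base i x : realization A x -> min_coord (Fs i) x = 0.
Proof.
move=> xA; have [x0 _ sA] := xA; apply: min_coord_eq0 => //.
by apply: contra (FA i) => Fx; exact: dA Fx.
Qed.

Lemma min_coord_other i j x : realization K x -> supp x = Fs i -> j != i ->
  min_coord (Fs j) x = 0.
Proof.
move=> xK sx ji; have [x0 _ _] := xK; apply: min_coord_eq0 => //.
by apply: contra ji => Fx; apply/eqP/injF; rewrite -sx (cells_subset xK Fx).
Qed.

Lemma cells_cases x : realization K x ->
  realization A x \/ exists i, supp x = Fs i.
Proof.
move=> xK; have [x0 x1] := xK; rewrite KE => /orP[xA|/existsP[i /eqP ?]].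
  by left.
by right; exists i.
Qed.

Let N : R := d.+1%:R.
Let N0 : 0 < N. Proof. by rewrite ltr0n. Qed.
(** Within a cell, [push] subtracts the same amount from all coordinates and renormalizes, moving
    the point away from the barycenter. The cap [t / (2 * N)] bounds the removed mass by [t / 2], so
    on [|K|] the maximum in [den] is its second argument; the bound [1 / 2] only prevents division
    by zero elsewhere in the ambient space. At most one summand is nonzero at a point of [|K|], so
    the sums treat all cells at once. *)
Let shift i t x : R := Num.min (min_coord (Fs i) x) (t / (2 * N)).
Let den t x : R := Num.max (1 / 2) (1 - N * \sum_i shift i t x).
Let push t x : V :=
  \row_k ((x ord0 k - \sum_i shift i t x * (k \in Fs i)%:R) / den t x).

Let continuous_shift i : continuous (fun z : R * V => shift i z.1 z.2).
Proof.
apply: continuous_minf; last by cont.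
by apply: continuous_min_coord; exact: continuous_snd.
Qed.

Let continuous_push : continuous (fun z : R * V => push z.1 z.2).
Proof.
apply: continuous_row => k; apply: continuous_divf.
- by cont; exact: continuous_shift.
- by rewrite /den; cont; exact: continuous_shift.
- move=> z; rewrite gt_eqF // /den lt_max; apply/orP; left; lra.
Qed.

Let push_base t x : 0 <= t -> realization A x -> push t x = x.
Proof.
move=> t0 xA.
have s0 i : shift i t x = 0.
  rewrite /shift min_coord_base //; apply/min_idPl.
  by rewrite mulr_ge0 // invr_ge0 mulr_ge0 // ltW.
apply/rowP => k; rewrite mxE /den !big1 => [|i _|i _]; rewrite ?s0 ?mul0r //.
have -> : Num.max (1 / 2) (1 - N * 0) = 1 :> R.
  by rewrite mulr0 subr0; apply/max_idPr; lra.
by rewrite subr0 divr1.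
Qed.

Let push_cell t x i (c := shift i t x) : 0 <= t <= 1 -> realization K x -> supp x = Fs i ->
  [/\ 0 <= c <= min_coord (Fs i) x, N * c <= t / 2 &
      forall k, push t x ord0 k = (x ord0 k - c * (k \in Fs i)%:R) / (1 - N * c)].
Proof.
move=> /andP[t0 t1] xK sx; have [x0 x1 _] := xK.
have T0 : 0 <= t / (2 * N) by rewrite mulr_ge0 // invr_ge0 mulr_ge0 // ltW.
have Nc : N * c <= t / 2.
  rewrite (_ : t / 2 = N * (t / (2 * N))); last by field; rewrite gt_eqF.
  by rewrite ler_pM2l // ge_min lexx orbT.
split => //.
  by rewrite le_min min_coord_ge0 //= T0 ge_min lexx.
move=> k; rewrite mxE /den.
have s0 j : j != i -> shift j t x = 0.
  by move=> ji; rewrite /shift (min_coord_other xK sx ji); apply/min_idPl.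
rewrite (bigD1 i) //= big1 ?addr0 => [|j ji]; last by rewrite s0 ?mul0r.
rewrite (bigD1 i) //= big1 ?addr0 => [|j ji]; last by rewrite s0.
by rewrite (_ : Num.max _ _ = 1 - N * c) //; apply/max_idPr; rewrite -/c; lra.
Qed.

(** This is the homotopy extension property with an explicit formula. A point of a cell reaches the
    boundary when [t] is [2 * N] times its smallest coordinate, if that is at most 1; from then on
    [h] acts on the boundary point for the remaining time. Since [h] is the identity at time 0, one
    expression covers both phases. *)
Lemma extend_contraction h v : ambient_contraction A h v ->
  exists H : R * V -> V,
  [/\ continuous H, forall x, realization K x -> H (0, x) = x,
      forall t x, 0 <= t <= 1 -> realization K x -> realization K (H (t, x)),
      forall t x, 0 <= t <= 1 -> realization A x -> realization A (H (t, x))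
    & forall x, realization A x -> H (1, x) = v].
Proof.
move=> [ch h0 hA vA h1].
pose M x : R := \sum_i min_coord (Fs i) x.
pose H (z : R * V) := h (Num.max 0 (z.1 - 2 * N * M z.2), push z.1 z.2).
have M0 x : realization A x -> M x = 0.
  by move=> xA; rewrite /M big1 // => i _; exact: min_coord_base.
have Mi x i : realization K x -> supp x = Fs i -> M x = min_coord (Fs i) x.
  move=> xK sx; rewrite /M (bigD1 i) //= big1 ?addr0 // => j ji.
  exact: min_coord_other sx ji.
have HA t x : 0 <= t <= 1 -> realization A x -> H (t, x) = h (t, x).
  move=> /andP[t0 t1] xA; rewrite /H /= M0 // push_base // mulr0 subr0.
  by rewrite (_ : Num.max 0 t = t) //; apply/max_idPr.
exists H; split.
- apply: (@continuous_compose _ _ _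
    (fun z : R * V => (Num.max 0 (z.1 - 2 * N * M z.2), push z.1 z.2)) h) => //.
  apply: continuous_pair; last exact: continuous_push.
  by rewrite /M; cont; apply: continuous_min_coord; exact: continuous_snd.
- move=> x xK; have [xA|[i sx]] := cells_cases xK.
    by rewrite HA // ?lexx ?ler01.
  have [x0 _ _] := xK.
  rewrite /H /= (Mi x i) // sub0r.
  have -> : Num.max 0 (- (2 * N * min_coord (Fs i) x)) = 0.
    by apply/max_idPl; rewrite oppr_le0 !mulr_ge0 // ?min_coord_ge0 // ltW.
  have t01 : 0 <= (0 : R) <= 1 by rewrite lexx ler01.
  have [_ _ E] := push_cell t01 xK sx.
  rewrite h0; apply/rowP => k; rewrite E.
  have -> : shift i 0 x = 0.
    by rewrite /shift mul0r; apply/min_idPr; exact: min_coord_ge0.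
  by rewrite mul0r mulr0 !subr0 divr1.
- move=> t x t01 xK; have [xA|[i sx]] := cells_cases xK.
    by rewrite HA //; apply: sub_realization; exact: hA.
  have /andP[t0 t1] := t01; have [x0 x1 _] := xK.
  have [/andP[c0 cm] Nc E] := push_cell t01 xK sx.
  set c := shift i t x in c0 cm Nc E.
  have D0 : 0 < 1 - N * c by lra.
  have p0 k : 0 <= push t x ord0 k.
    rewrite E; apply: mulr_ge0; last by rewrite invr_ge0 ltW.
    have [kF|_] := boolP (k \in Fs i); last by rewrite mulr0 subr0.
    by rewrite mulr1 subr_ge0 (le_trans cm) // min_coord_le.
  have p1 : \sum_k push t x ord0 k = 1.
    under eq_bigr do rewrite E.
    rewrite -mulr_suml sumrB x1 -mulr_sumr sum_indicator cardF -/N mulrC.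
    by rewrite (mulrC c) mulVf // gt_eqF.
  have pF k : k \notin Fs i -> push t x ord0 k = 0.
    move=> kF; rewrite E (negbTE kF) (coord_notin_supp _ kF) ?sx //.
    by rewrite mulr0 subr0 mul0r.
  rewrite /H /= (Mi x i) //.
  have [tm|tm] := lerP t (2 * N * min_coord (Fs i) x).
    rewrite (_ : Num.max _ _ = 0); last by apply/max_idPl; lra.
    rewrite h0; apply: (@realizationE _ _ _ _ (Fs i)) => //.
      exact: down_closed_cells.
    by rewrite KE; apply/orP; right; apply/existsP; exists i.
  rewrite (_ : Num.max _ _ = t - 2 * N * min_coord (Fs i) x); last by apply/max_idPr; lra.
  apply/sub_realization/hA.
    rewrite subr_ge0 (ltW tm) /= lerBlDr (le_trans t1) // lerDl.
    by rewrite !mulr_ge0 // ?min_coord_ge0 // ltW.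
  have [j jF] : exists j, j \in Fs i.
    by apply/card_gt0P; rewrite cardF.
  have [l lF ml] := min_coord_attained jF (fun k => realization_le1 k xK).
  apply: (@realizationE _ _ _ _ (Fs i :\ l)%SET) => //; first exact: bdF.
  move=> k; rewrite in_setD1 negb_and negbK => /orP[/eqP ->|]; last exact: pF.
  rewrite E lF -ml (_ : c = min_coord (Fs i) x) ?mulr1 ?subrr ?mul0r //.
  apply/min_idPl; rewrite ler_pdivlMr ?mulr_gt0 // mulrC; exact: ltW.
- by move=> t x t01 xA; rewrite HA //; exact: hA.
- by move=> x xA; rewrite HA ?ler01 ?lexx //; exact: h1.
Qed.

End Extension.

(** * Inverse stereographic projection from a simplex to a sphere *)

Section CellMap.
Variables (R : realType) (n d : nat).
Local Notation V := 'rV[R]_n.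
Variables (F : {set 'I_n}) (e : 'I_d.+1 -> 'I_n).

Definition enumerates := injective e /\ forall i, (i \in F) = [exists k, i == e k].

Hypothesis enum_e : enumerates.
Implicit Types (x : V) (y : 'rV[R]_d.+1).

Let inj_e : injective e. Proof. by case: enum_e. Qed.
Let eF k : e k \in F.
Proof. by case: enum_e => _ ->; apply/existsP; exists k. Qed.
Let Fe i : i \in F -> exists k, i = e k.
Proof. by case: enum_e => _ -> /existsP[k /eqP]; exists k. Qed.

Lemma sum_enumerates (f : 'I_n -> R) : \sum_(i in F) f i = \sum_k f (e k).
Proof.
have -> : F = (e @: [set: 'I_d.+1])%SET.
  apply/setP => i; apply/idP/imsetP => [/Fe[k ->]|[k _ -> //]].
  by exists k; rewrite ?finset.in_setT.
rewrite big_imset /=; last by move=> k l _ _; exact: inj_e.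
by apply: eq_bigl => k; rewrite finset.in_setT.
Qed.

(** It vanishes identically at [k = ord0], which frees the axis [ord0] of the ambient space of the
    sphere for the pole. *)
Definition edge_coord x k : R := x ord0 (e k) - x ord0 (e ord0).
Definition outer_part x : R := 1 - \sum_k x ord0 (e k).
Definition radius2 x : R :=
  \sum_k edge_coord x k * edge_coord x k + outer_part x * outer_part x.
Definition cell_den x : R := radius2 x + min_coord F x * min_coord F x.

(* Inverse stereographic projection of [edge_coord x / min_coord F x]: it sends
   the boundary of the simplex F to the base point of the sphere. The term
   [outer_part] vanishes on the simplex and keeps the denominator positive on
   the other faces. *)
Definition cell_map x : 'rV[R]_d.+1 :=
  \row_k ((2 * min_coord F x * edge_coord x k
     + (k == ord0)%:R * (radius2 x - min_coord F x * min_coord F x)) / cell_den x).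

Let w0 x : edge_coord x ord0 = 0. Proof. exact: subrr. Qed.

Let radius2_ge0 x : 0 <= radius2 x.
Proof.
by apply: addr_ge0; [apply: sumr_ge0 => k _|]; rewrite -expr2 sqr_ge0.
Qed.

(** If all the squares vanished, the coordinates on [F] would be equal, with minimum 0 and sum 1. *)
Lemma cell_den_gt0 x : (forall i, x ord0 i <= 1) -> 0 < cell_den x.
Proof.
move=> x1; rewrite lt_neqAle eq_sym addr_ge0 ?radius2_ge0 // -?expr2 ?sqr_ge0 // andbT.
apply/negP; rewrite /cell_den paddr_eq0 ?radius2_ge0 // -?expr2 ?sqr_ge0 //.
rewrite sqrf_eq0 => /andP[].
rewrite /radius2 paddr_eq0; last 2 first.
- by apply: sumr_ge0 => k _; rewrite -expr2 sqr_ge0.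
- by rewrite -expr2 sqr_ge0.
move=> /andP[/eqP w2 s2] /eqP m0.
have wk k : edge_coord x k = 0.
  apply/eqP; rewrite -sqrf_eq0 expr2; apply/eqP.
  by apply: (psumr_eq0P _ w2) => // l _; rewrite -expr2 sqr_ge0.
move: s2; rewrite -expr2 sqrf_eq0 /outer_part subr_eq0 => /eqP s1.
have [j jF mj] := min_coord_attained (eF ord0) x1.
have [l jl] := Fe jF.
have xk k : x ord0 (e k) = 0.
  have := wk k; have := wk l; rewrite /edge_coord -jl -mj m0; lra.
by move: s1; rewrite big1 // => /eqP; rewrite oner_eq0.
Qed.

(** With [m = min_coord F x] and [a = radius2 x], the identity [4 m^2 a + (a - m^2)^2 = (a + m^2)^2]
    gives norm 1 as soon as [a] is the sum of the squared edge coordinates, that is, when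
    [outer_part x = 0]. If [m = 0], that sum drops out. *)
Lemma cell_map_sphere x : (forall i, x ord0 i <= 1) ->
  min_coord F x = 0 \/ outer_part x = 0 -> sphere_set R d (cell_map x).
Proof.
move=> /cell_den_gt0 D0 ms; rewrite /sphere_set /=.
set m := min_coord F x in ms *; set a := radius2 x.
have -> : \sum_i cell_map x ord0 i ^+ 2 =
   (4 * m * m * (\sum_k edge_coord x k * edge_coord x k) + (a - m * m) ^+ 2)
     / cell_den x ^+ 2.
  transitivity ((\sum_k (4 * m * m * (edge_coord x k * edge_coord x k)
       + (k == ord0)%:R * (a - m * m) ^+ 2)) / cell_den x ^+ 2).
    rewrite mulr_suml; apply: eq_bigr => k _; rewrite mxE -/m -/a exprMn exprVn.
    congr (_ / _); case: (k =P ord0) => [->|_] /=; rewrite ?w0; ring.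
  by rewrite big_split /= -mulr_sumr -mulr_suml sum_delta mul1r.
have D2 : cell_den x ^+ 2 != 0 by rewrite expf_neq0 // gt_eqF.
apply: (mulIf D2); rewrite mulfVK // mul1r /cell_den -/m -/a.
case: ms => [->|s0]; first by ring.
have -> : \sum_k edge_coord x k * edge_coord x k = a by rewrite /a /radius2 s0 mul0r addr0.
by ring.
Qed.

Lemma cell_map_base x : (forall i, x ord0 i <= 1) -> min_coord F x = 0 ->
  cell_map x = delta_mx ord0 ord0.
Proof.
move=> /cell_den_gt0 D0 m0; apply/rowP => k; rewrite !mxE m0 eqxx /=.
have aD : radius2 x = cell_den x by rewrite /cell_den m0 mulr0 addr0.
rewrite aD mulr0 mul0r add0r mulr0 subr0 -mulrA divff ?mulr1 //.
by rewrite gt_eqF.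
Qed.

Let cell_map0 x : (forall i, x ord0 i <= 1) ->
  1 - cell_map x ord0 ord0 = 2 * min_coord F x ^+ 2 / cell_den x.
Proof.
move=> /cell_den_gt0 D0; rewrite mxE w0 eqxx mul1r mulr0 add0r.
apply: (@mulIf _ (cell_den x)); first by rewrite gt_eqF.
rewrite mulfVK ?gt_eqF // mulrBl mulfVK ?gt_eqF // /cell_den; ring.
Qed.

Lemma cell_map_neq_base x : (forall i, x ord0 i <= 1) -> min_coord F x != 0 ->
  cell_map x != delta_mx ord0 ord0.
Proof.
move=> x1 m0; apply/eqP => E; have := cell_map0 x1.
rewrite E mxE !eqxx subrr => /esym/eqP.
have /gt_eqF D0 := cell_den_gt0 x1.
by rewrite mulf_eq0 invr_eq0 D0 orbF mulf_eq0 sqrf_eq0 (negbTE m0) pnatr_eq0.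
Qed.

Let ratio x k : (forall i, x ord0 i <= 1) -> min_coord F x != 0 ->
  edge_coord x k = min_coord F x *
    ((k != ord0)%:R * cell_map x ord0 k / (1 - cell_map x ord0 ord0)).
Proof.
move=> x1 m0; rewrite cell_map0 //; have D0 := cell_den_gt0 x1.
have [->|k0] := eqVneq k ord0; first by rewrite w0 /= !mul0r mulr0.
rewrite mxE (negbTE k0) /=; field.
by rewrite m0 gt_eqF.
Qed.

Lemma cell_map_inj x x' : (forall i, 0 <= x ord0 i) -> (forall i, 0 <= x' ord0 i) ->
  \sum_i x ord0 i = 1 -> \sum_i x' ord0 i = 1 ->
  supp x = F -> supp x' = F -> cell_map x = cell_map x' -> x = x'.
Proof.
move=> p p' s s' sx sx' E.
have le1 (z : V) : (forall i, 0 <= z ord0 i) -> \sum_i z ord0 i = 1 -> forall i, z ord0 i <= 1 :> R.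
  move=> z0 z1 i; rewrite -z1 (bigD1 i) //= lerDl; exact: sumr_ge0.
have x1 := le1 _ p s; have x1' := le1 _ p' s'.
have m0 : 0 < min_coord F x by rewrite min_coord_gt0 // sx.
have m0' : 0 < min_coord F x' by rewrite min_coord_gt0 // sx'.
set m := min_coord F x in m0; set m' := min_coord F x' in m0'.
have Ew k : m * edge_coord x' k = m' * edge_coord x k.
  have := ratio k x1 (lt0r_neq0 m0); have := ratio k x1' (lt0r_neq0 m0').
  by rewrite E -/m -/m' => -> ->; ring.
(* Equal images have equal stereographic coordinates, so on [F] the vectors [m x'] and [m' x] differ
   by a constant [b]. Comparing them where [x], and where [x'], attains its minimum gives [b >= 0]
   and [b <= 0]; the coordinate sums then give [m = m']. *)
pose b := m * x' ord0 (e ord0) - m' * x ord0 (e ord0).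
have Ex k : m * x' ord0 (e k) = m' * x ord0 (e k) + b.
  by have := Ew k; rewrite /edge_coord !mulrBr /b => ?; lra.
have b0 : b = 0.
  have [j jF mj] := min_coord_attained (eF ord0) x1.
  have [j' jF' mj'] := min_coord_attained (eF ord0) x1'.
  have [l jl] := Fe jF; have [l' jl'] := Fe jF'.
  have := min_coord_le x' jF; have := min_coord_le x jF'.
  rewrite -/m -/m' => h1 h2.
  rewrite -/m jl in mj; rewrite -/m' jl' in mj'; rewrite jl in h2; rewrite jl' in h1.
  have := Ex l; have := Ex l'; rewrite -mj -mj' => e1 e2.
  have g1 : m * m' <= m * x' ord0 (e l) by rewrite ler_pM2l.
  have g2 : m' * m <= m' * x ord0 (e l') by rewrite ler_pM2l.
  rewrite mulrC in g2; rewrite (mulrC m') in e2.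
  by apply/eqP; rewrite eq_le; apply/andP; split; lra.
have mm : m = m'.
  have : m * \sum_k x' ord0 (e k) = m' * \sum_k x ord0 (e k).
    by rewrite !mulr_sumr; apply: eq_bigr => k _; rewrite Ex b0 addr0.
  by rewrite -!(sum_enumerates (fun i => _ ord0 i)) !sum_supp ?sx ?sx' // s s' !mulr1.
apply/rowP => i; have [/Fe[k ->]|iF] := boolP (i \in F).
  by have := Ex k; rewrite b0 addr0 mm => /mulfI ->; rewrite ?gt_eqF.
by rewrite !(coord_notin_supp _ iF) ?sx ?sx'.
Qed.

Lemma cell_map_surj y : sphere_set R d y -> y != delta_mx ord0 ord0 ->
  exists x, [/\ forall i, 0 <= x ord0 i, \sum_i x ord0 i = 1, supp x = F & cell_map x = y].
Proof.
rewrite /sphere_set /= => y1 yb.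
set c := y ord0 ord0.
pose q2 := \sum_(k | k != ord0) y ord0 k ^+ 2.
have q2E : c ^+ 2 + q2 = 1 by rewrite -y1 (bigD1 ord0).
have q20 : 0 <= q2 by apply: sumr_ge0 => k _; exact: sqr_ge0.
have c1 : c < 1.
  rewrite lt_neqAle; apply/andP; split; last by rewrite leNgt; apply/negP => ?; nra.
  apply: contra yb => /eqP cE; apply/eqP/rowP => k; rewrite mxE eqxx /=.
  have [->|k0] := eqVneq k ord0; first exact: cE.
  have q0 : q2 = 0 by move: q2E; rewrite cE expr1n; lra.
  apply/eqP; rewrite -sqrf_eq0; apply/eqP.
  by apply: (psumr_eq0P _ q0) => // l _; exact: sqr_ge0.
(* [u] is the stereographic projection of [y]. The preimage is [u] translated to have minimum 1 and
   divided by its total [T]: its smallest coordinate is [1 / T], so its edge coordinates divided by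
   that minimum are [u] again. *)
pose u k := (k != ord0)%:R * y ord0 k / (1 - c).
have u0 : u ord0 = 0 by rewrite /u eqxx /= !mul0r.
have [j muP] : exists j, forall k, u j <= u k.
  by case: (@arg_minP _ _ _ ord0 xpredT u isT) => j _ h; exists j => k; exact: h.
pose q k := u k + 1 - u j.
have q1 k : 1 <= q k by have := muP k; rewrite /q; lra.
have qj : q j = 1 by rewrite /q; lra.
pose T := \sum_k q k.
have T0 : 0 < T.
  rewrite /T (bigD1 ord0) //= ltr_pwDl //; first by have := q1 ord0; lra.
  by apply: sumr_ge0 => k _; have := q1 k; lra.
pose x : V := \row_i \sum_k (i == e k)%:R * (q k / T).
have xe k : x ord0 (e k) = q k / T.
  rewrite mxE (bigD1 k) //= eqxx mul1r big1 ?addr0 // => l lk.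
  by rewrite (inj_eq inj_e) eq_sym (negbTE lk) mul0r.
have xF i : i \notin F -> x ord0 i = 0.
  move=> iF; rewrite mxE big1 // => k _.
  by case: eqP iF => [->|]; rewrite ?eF ?mul0r.
have q0 k : 0 < q k / T by rewrite divr_gt0 //; have := q1 k; lra.
have x0 i : 0 <= x ord0 i.
  by have [/Fe[k ->]|/xF ->//] := boolP (i \in F); rewrite xe ltW.
have sx : supp x = F.
  apply/setP => i; rewrite in_supp; have [/Fe[k ->]|/xF ->] := boolP (i \in F).
    by rewrite xe gt_eqF.
  by rewrite eqxx.
have xs : \sum_k x ord0 (e k) = 1.
  by under eq_bigr do rewrite xe; rewrite -mulr_suml divff // gt_eqF.
have x1 : \sum_i x ord0 i = 1.
  by rewrite -(@sum_supp _ _ _ F) ?sx // sum_enumerates.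
have xle i : x ord0 i <= 1.
  by rewrite -x1 (bigD1 i) //= lerDl; exact: sumr_ge0.
exists x; split => //.
have mE : min_coord F x = T^-1.
  apply/le_anti/andP; split.
    by have := min_coord_le x (eF j); rewrite xe qj div1r.
  have [i /Fe[k ->] ->] := min_coord_attained (eF ord0) xle.
  by rewrite xe ler_peMl // invr_ge0 ltW.
have wE k : edge_coord x k = u k / T.
  by rewrite /edge_coord !xe /q u0; field; rewrite gt_eqF.
have sE : outer_part x = 0 by rewrite /outer_part xs subrr.
have uE : \sum_k u k * u k = (1 + c) / (1 - c).
  transitivity (q2 / (1 - c) ^+ 2).
    rewrite (bigD1 ord0) //= u0 mul0r add0r /q2 mulr_suml; apply: eq_bigr => k k0.
    by rewrite /u k0 /=; field; rewrite gt_eqF //; lra.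
  have -> : q2 = (1 - c) * (1 + c) by move: q2E; lra.
  by field; rewrite gt_eqF //; lra.
have rE : radius2 x = (1 + c) / (1 - c) / T ^+ 2.
  rewrite /radius2 sE mulr0 addr0 -uE mulr_suml; apply: eq_bigr => k _.
  by rewrite wE; field; rewrite gt_eqF.
have c1' : 1 - c != 0 by rewrite gt_eqF //; lra.
have T0' : T != 0 by rewrite gt_eqF.
have DE : cell_den x = 2 / (1 - c) / T ^+ 2.
  by rewrite /cell_den rE mE; field; rewrite c1' T0'.
apply/rowP => k; rewrite mxE DE mE wE rE.
have [->|k0] := eqVneq k ord0.
  by rewrite u0 -/c /=; field; rewrite c1' T0'.
by rewrite /u k0 /=; field; rewrite c1' T0'.
Qed.

End CellMap.

Lemma enumerates_exists n d (F : {set 'I_n}) : #|F| = d.+1 ->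
  exists e : 'I_d.+1 -> 'I_n, enumerates F e.
Proof.
move=> cF; exists (fun k => enum_val (cast_ord (esym cF) k)); split.
  by move=> k l /enum_val_inj /cast_ord_inj.
move=> i; apply/idP/existsP => [iF|[k /eqP ->]]; last exact: enum_valP.
exists (cast_ord cF (enum_rank_in iF i)).
by rewrite cast_ordK enum_rankK_in.
Qed.

Definition in_set_type (U : Type) (B : set U) (u : U) (Bu : B u) : set_type B :=
  exist (fun v => v \in B) u (mem_set Bu).

Lemma set_type_hausdorff (U : topologicalType) (B : set U) :
  hausdorff_space U -> hausdorff_space (set_type B).
Proof.
move=> hU x y cl; apply: val_inj; apply: hU => P Q Px Qy.
have [z [Pz Qz]] := cl _ _ (continuous_set_val Px) (continuous_set_val Qy).
by exists (set_val z).
Qed.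

Lemma set_type_compact (U : topologicalType) (B : set U) :
  compact B -> compact [set: set_type B].
Proof.
move=> cB; have [/eqP B0|/set0P[b Bb]] := boolP (B == set0).
  have -> : [set: set_type B] = set0.
    apply/seteqP; split => // x _.
    have [u Bu] : exists u, B u by exists (set_val x); exact: set_valP.
    by rewrite B0 in Bu.
  exact: compact0.
pose b' : set_type B := in_set_type Bb.
pose g (u : U) : set_type B := insubd b' u.
have gK x : g (set_val x) = x by rewrite /g; exact: valKd.
have -> : [set: set_type B] = g @` B.
  apply/seteqP; split => // x _; exists (set_val x); [exact: set_valP|exact: gK].
apply: continuous_compact => //; apply/subspace_sigL_continuousP.
have -> : sigL B g = id by apply/funext => x; exact: gK.
by move=> x; exact: cvg_id.
Qed.

(** * The collapse map onto the wedge of spheres *)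

Section Assembly.
Variables (R : realType) (n d m : nat).
Local Notation V := 'rV[R]_n.
Variables (A K : {set {set 'I_n}}) (Fs : 'I_m.+1 -> {set 'I_n}).
Hypothesis cells : attached_cells d A K Fs.
Variable e : 'I_m.+1 -> 'I_d.+1 -> 'I_n.
Hypothesis enum_e : forall i, enumerates (Fs i) (e i).

Local Notation X := (set_type (realization (R := R) K)).
Local Notation S := (sphere R d).
Local Notation W := (wedge_of_spheres R m.+1 d).
Local Notation base := (sphere_base R d).
Let lift i : S -> W := @wedge_lift 'I_m.+1 (fun _ => S) (fun _ => base) i.

Let xP (x : X) : realization K (set_val x). Proof. exact: set_valP. Qed.
Let xle (x : X) i : set_val x ord0 i <= 1. Proof. exact: realization_le1 (xP x). Qed.

Let on_sphere i (x : X) : sphere_set R d (cell_map (Fs i) (e i) (set_val x)).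
Proof.
apply: cell_map_sphere => //.
have [x0 x1 _] := xP x.
have [Fx|Fx] := boolP (Fs i \subset supp (set_val x)); last first.
  by left; exact: min_coord_eq0.
right; rewrite /outer_part; have sx := cells_subset cells (xP x) Fx.
rewrite -(sum_enumerates (enum_e i)) (@sum_supp _ _ _ (Fs i)) ?sx // x1 subrr //.
Qed.

Let sph i (x : X) : S := in_set_type (on_sphere i x).

Let continuous_sph i : continuous (sph i).
Proof.
apply: continuous_to_set_type; apply: continuous_row => k.
have cx := @continuous_set_val _ (realization (R := R) K).
have cc j : continuous (fun x : X => set_val x ord0 j) by apply: continuous_coordf.
have cm : continuous (fun x : X => min_coord (Fs i) (set_val x)).
  exact: continuous_min_coord.
have cw l : continuous (fun x : X => edge_coord (e i) (set_val x) l).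
  by rewrite /edge_coord; cont; exact: cc.
have co : continuous (fun x : X => outer_part (e i) (set_val x)).
  by rewrite /outer_part; cont; exact: cc.
have cr : continuous (fun x : X => radius2 (e i) (set_val x)).
  by rewrite /radius2; cont; try exact: cw; exact: co.
apply: continuous_divf.
- by cont; exact: cw.
- by rewrite /cell_den; cont.
- by move=> x; rewrite gt_eqF // cell_den_gt0.
Qed.

(** The default [ord0] applies to points of [|A|], where it does not matter: every cell map sends
    them to its base point, and the wedge identifies these. *)
Let idx (x : X) : 'I_m.+1 := odflt ord0 [pick i | Fs i == supp (set_val x)].
Let f (x : X) : W := lift (idx x) (sph (idx x) x).

Let idx_cell i (x : X) : supp (set_val x) = Fs i -> idx x = i.
Proof.
move=> sx; rewrite /idx; case: pickP => [j /eqP sj|/(_ i)]; last by rewrite sx eqxx.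
by have [_ injF _ _] := cells; apply: injF; rewrite sj sx.
Qed.

Let sph_base i (x : X) : min_coord (Fs i) (set_val x) = 0 -> sph i x = base.
Proof. by move=> m0; apply: val_inj => /=; exact: cell_map_base. Qed.

Let sph_neq_base i (x : X) : supp (set_val x) = Fs i -> sph i x != base.
Proof.
move=> sx; have [x0 _ _] := xP x; apply/eqP => /(congr1 val) /= /eqP; apply/negP.
by apply: cell_map_neq_base => //; rewrite gt_eqF // min_coord_gt0 // sx.
Qed.

Let lift_base i j : lift i base = lift j base.
Proof. exact: (@wedge_liftE 'I_m.+1 (fun _ => S) (fun _ => base) j base i base). Qed.

Let lift_eq i j (y z : S) : lift i y = lift j z ->
  (i = j /\ y = z) \/ (y = base /\ z = base).
Proof.
move=> /eqmodP /predU1P[E|/andP[/eqP /= -> /eqP /= ->]]; last by right.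
left; split; first exact: (congr1 (fun s => projT1 s) E).
exact: (congr1 (fun s : {_ : 'I_m.+1 & S} => projT2 s) E).
Qed.

Let f_base (x : X) : realization A (set_val x) -> f x = lift ord0 base.
Proof.
by move=> xA; rewrite /f sph_base ?(min_coord_base cells) //; exact: lift_base.
Qed.

Let f_cell i (x : X) : supp (set_val x) = Fs i -> f x = lift i (sph i x).
Proof. by move=> sx; rewrite /f (idx_cell sx). Qed.

Let closed_base : closed [set base].
Proof.
apply: accessible_closed_set1; apply: hausdorff_accessible.
by apply: set_type_hausdorff; exact: norm_hausdorff.
Qed.

(** Near a point of [|A|] the index may jump, but there are finitely many spheres, so a single
    neighbourhood serves for all the maps [sph i]. Near a point inside cell [i], the set where
    [min_coord (Fs i)] is positive is open, and there [f] is [sph i] followed by the inclusion into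
    the wedge. *)
Let continuous_f : continuous f.
Proof.
move=> x; have [xA|[i sx]] := cells_cases cells (xP x).
  rewrite /continuous_at f_base // => U; rewrite /lift wedge_point_nbhs => Ub.
  have : \forall y \near x, forall i, U (lift i (sph i y)).
    apply: (@filter_forall X _ (fun i (y : X) => U (lift i (sph i y)))
      (nbhs x) (nbhs_filter x)) => i.
    apply: (@continuous_sph i x (lift i @^-1` U)).
    rewrite sph_base ?(min_coord_base cells) //.
    exact: Ub.
  by rewrite nbhs_simpl /=; apply: filterS => y; apply.
have /continuous_closedP/(_ [set y | y <= 0] (@closed_le _ _)) cm :
    continuous (fun y : X => min_coord (Fs i) (set_val y)).
  by apply: continuous_min_coord; exact: continuous_set_val.
rewrite /continuous_at (f_cell sx) => U Ux; rewrite nbhs_simpl /=.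
have hpos : nbhs x (~` [set y : X | min_coord (Fs i) (set_val y) <= 0]).
  apply: open_nbhs_nbhs; split; first exact: closed_openC.
  have [x0 _ _] := xP x.
  by apply/negP; rewrite -ltNge min_coord_gt0 // sx.
have hU := (continuous_compose (@continuous_sph i) (@wedge_lift_continuous _ _ _ i)) x U Ux.
apply: (@filterS X (nbhs x) (nbhs_filter x) _ _ _
  (@filterI _ _ (nbhs_filter x) _ _ hU hpos)) => y [Uy /= /negP].
rewrite -ltNge; have [y0 _ _] := xP y.
rewrite min_coord_gt0 // => /(cells_subset cells (xP y)) sy.
by rewrite (f_cell sy).
Qed.

Let f_surj v : realization (R := R) A v -> forall z : W, exists x, f x = z.
Proof.
move=> vA z.
have : (\bigcup_i (@wedge_lift 'I_m.+1 (fun _ => S) (fun _ => base) i) @` setT) z.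
  by rewrite wedgeTE.
case=> i _ [y _ <-]; have [->|yb] := eqVneq y base.
  exists (in_set_type (sub_realization cells vA) : X).
  by rewrite f_base //; exact: lift_base.
have yb' : val y != delta_mx ord0 ord0.
  by apply: contra yb => /eqP E; apply/eqP/val_inj.
have [x [x0 x1 sx E]] := cell_map_surj (enum_e i) (set_valP y) yb'.
have xK : realization K x.
  split => //; have [_ _ _ ->] := cells; rewrite sx.
  by apply/orP; right; apply/existsP; exists i.
pose x' : X := in_set_type xK.
by exists x'; rewrite (@f_cell i) //; congr lift; exact: val_inj.
Qed.

Let f_fiber (x x' : X) : f x = f x' ->
  x = x' \/ (realization A (set_val x) /\ realization A (set_val x')).
Proof.
have [xA|[i sx]] := cells_cases cells (xP x);
  have [xA'|[i' sx']] := cells_cases cells (xP x').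
- by right.
- rewrite (f_base xA) (f_cell sx') => /lift_eq[[_ E]|[_ E]];
    by have := sph_neq_base sx'; rewrite -?E ?E eqxx.
- rewrite (f_base xA') (f_cell sx) => /lift_eq[[_ E]|[E _]];
    by have := sph_neq_base sx; rewrite E eqxx.
- rewrite (f_cell sx) (f_cell sx') => /lift_eq[[ii E]|[E _]]; last first.
    by have := sph_neq_base sx; rewrite E eqxx.
  left; apply: val_inj; rewrite -ii in sx' E.
  have [x0 x1 _] := xP x; have [x0' x1' _] := xP x'.
  apply: (cell_map_inj (enum_e i)) => //.
  exact: (congr1 val E).
Qed.

Lemma homotopy_equivalent_enumerated_cells :
  (exists h v, ambient_contraction (R := R) A h v) ->
  homotopy_equivalent R X W.
Proof.
move=> [h [v hv]]; have [_ _ _ vA _] := hv.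
have [H [cH H0 HK HA H1]] := extend_contraction cells hv.
(* [H] preserves [|K|] only for times in [[0, 1]], whereas the homotopy with values in [X] must be
   defined for every real time. *)
pose clamp (t : R) : R := Num.max 0 (Num.min 1 t).
have clampP t : 0 <= clamp t <= 1.
  by rewrite /clamp le_max lexx /= ge_max ler01 ge_min lexx.
have clampE t : 0 <= t <= 1 -> clamp t = t.
  by move=> /andP[t0 t1]; rewrite /clamp (min_idPr t1); apply/max_idPr.
pose G (z : R * X) : X := in_set_type (HK _ _ (clampP z.1) (xP z.2)).
apply: (@quotient_homotopy_equivalent _ _ _ f G) => //.
- by apply: set_type_compact; apply: realization_compact; exact: down_closed_cells cells.
- apply: wedge_hausdorff => // _.
  by apply: set_type_hausdorff; exact: norm_hausdorff.
- exact: f_surj vA.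
- apply: continuous_to_set_type.
  apply: (@continuous_compose _ _ _ (fun z : R * X => (clamp z.1, set_val z.2)) H) => //.
  apply: continuous_pair; first by rewrite /clamp; cont.
  exact: continuous_compose (@continuous_snd _ _) (@continuous_set_val _ _).
- move=> x; apply: val_inj => /=; rewrite clampE ?lexx ?ler01 //.
  exact: H0.
- move=> t x x' t01 /f_fiber[-> //|[xA xA']].
  by rewrite !f_base //=; exact: HA.
- move=> x x' /f_fiber[-> //|[xA xA']].
  apply: val_inj => /=; rewrite clampE ?lexx ?ler01 //.
  by rewrite !H1.
Qed.

End Assembly.

Theorem homotopy_equivalent_attached_cells (R : realType) n d m
    (A K : {set {set 'I_n}}) (Fs : 'I_m -> {set 'I_n}) :
  (0 < m)%N -> attached_cells d A K Fs ->
  (exists h v, ambient_contraction (R := R) A h v) ->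
  homotopy_equivalent R (geometric_realization R K) (wedge_of_spheres R m d).
Proof.
case: m Fs => // m Fs _ cells.
have cF i : #|Fs i| = d.+1 by case: cells => _ _ /(_ i)[].
have /choice[e eP] i := enumerates_exists (cF i).
exact: (homotopy_equivalent_enumerated_cells cells eP).
Qed.

(** * Shellings *)

Section Shelling.
Variable T : finType.
Implicit Types (s sh : seq {set T}) (F G : {set T}).

Definition complex_of s : {set {set T}} := (\bigcup_(F <- s) powerset F)%SET.

Lemma in_complex_of s G : reflect (exists2 F, F \in s & G \subset F) (G \in complex_of s).
Proof.
rewrite /complex_of; elim: s => [|F s IH].
  by rewrite big_nil finset.in_set0; constructor => -[].
rewrite big_cons finset.in_setU powersetE; apply: (iffP orP) => [[GF|/IH[H Hs GH]]|[H]].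
- by exists F; rewrite ?mem_head.
- by exists H; rewrite ?inE ?Hs ?orbT.
- by rewrite inE => /predU1P[->|Hs] GH; [left|right; apply/IH; exists H].
Qed.

(** The exchange form of the shelling condition: the intersection of [F] with an earlier facet lies
    in a codimension-one face of [F] that is already present. *)
Definition attaches s F : Prop := forall G, G \in s ->
  exists v, [/\ v \in F, v \notin G & (F :\ v)%SET \in complex_of s].

(** In the usual terminology, [F] is a spanning (or homology) facet of the shelling. *)
Definition closes s F : bool := [forall v in F, (F :\ v)%SET \in complex_of s].

Definition attaching sh : Prop :=
  forall j, (0 < j < size sh)%N -> attaches (take j sh) (nth finset.set0 sh j).

Definition num_closing sh : nat :=
  count (fun j => closes (take j sh) (nth finset.set0 sh j)) (iota 0 (size sh)).

(** A facet [s] of the intersection lies in an earlier [G]. The exchange vertex [v] for [G] is not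
    in [s], so [s] is contained in [F :\ v], which also belongs to the intersection; by maximality
    they are equal. *)
Lemma attaching_shelling sh : attaching sh -> shelling sh.
Proof.
move=> att i /[dup] i0 /att atti s; set F := nth _ sh i in atti *.
rewrite !inE -!andbA => /and3P[sK sF /forallP smax].
have /in_complex_of[G Gs sG] : s \in complex_of (take i sh) by [].
have [v [vF vG FvK]] := atti G Gs.
have sFv : s \subset (F :\ v)%SET.
  by rewrite finset.subsetD1 sF; apply: contra vG; exact: (fintype.subsetP sG).
have := smax (F :\ v)%SET; rewrite sFv inE powersetE finset.subsetDl.
rewrite [X in X && _]FvK /= => /eqP <-.
by rewrite /face_dim (cardsD1 v F) vF /=; lia.
Qed.

End Shelling.

(** Closing facets can be postponed: such a facet adds no proper face, so the later facets attach in
    the same way to the complex [A] built without it. *)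
Lemma attaching_cells (R : realType) n d (sh : seq {set 'I_n}) :
  attaching sh -> uniq sh -> (forall F, F \in sh -> #|F| = d.+1) -> (0 < size sh)%N ->
  exists (A : {set {set 'I_n}}) (hs : seq {set 'I_n}),
  [/\ [/\ uniq hs, {subset hs <= sh} & size hs = num_closing sh],
      down_closed A, exists h v, ambient_contraction (R := R) A h v,
      forall F, F \in hs -> F \notin A /\ forall v, v \in F -> (F :\ v)%SET \in A
    & forall G, G \in complex_of sh = (G \in A) || (G \in hs)].
Proof.
elim/last_ind: sh => // s F IH att us cs _.
have Fs : F \notin s by move: us; rewrite rcons_uniq => /andP[].
have cF : #|F| = d.+1 by apply: cs; rewrite mem_rcons inE eqxx.
have cK G : G \in rcons s F -> F \subset G -> G = F.
  by move=> Gs FG; apply/esym/eqP; rewrite eqEcard FG cF (cs _ Gs) leqnn.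
have KE G : G \in complex_of (rcons s F) = (G \in complex_of s) || (G \subset F).
  apply/in_complex_of/orP => [[H]|[/in_complex_of[H Hs GH]|GF]].
  - rewrite mem_rcons inE => /predU1P[->|Hs] GH; first by right.
    by left; apply/in_complex_of; exists H.
  - by exists H => //; rewrite mem_rcons inE Hs orbT.
  - by exists F => //; rewrite mem_rcons inE eqxx.
have FK : F \notin complex_of s.
  apply/negP => /in_complex_of[G Gs FG].
  by move: Fs; rewrite -(cK G) ?Gs // mem_rcons inE Gs orbT.
have tk : take (size s) (rcons s F) = s by rewrite -cats1 take_size_cat.
have numE : num_closing (rcons s F) = (num_closing s + closes s F)%N.
  rewrite /num_closing size_rcons -addn1 iotaD count_cat /= addn0 add0n.
  rewrite tk nth_rcons ltnn eqxx; congr addn.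
  apply: eq_in_count => j; rewrite mem_iota add0n => /andP[_ js].
  by rewrite nth_rcons js -cats1 takel_cat // ltnW.
case: (posnP (size s)) => [/size0nil s0|s_gt0].
  rewrite s0 in KE numE *.
  have [w wF] : exists w, w \in F by apply/card_gt0P; rewrite cF.
  exists (powerset F), [::]; split => //.
  - split => //; rewrite numE /num_closing /=.
    have -> // : closes [::] F = false.
    apply/negP => /forallP/(_ w); rewrite wF /= => /in_complex_of[G].
    by rewrite in_nil.
  - exact: down_closed_powerset.
  - exact: simplex_contraction wF.
  - move=> G; rewrite KE powersetE orbF; apply: orb_idl.
    by move=> /in_complex_of[H]; rewrite in_nil.
have [||||A [hs [[uhs shs nhs] dA hA homA AE]]] := IH.
- move=> j /andP[j0 js]; have := att j; rewrite j0 size_rcons ltnS (ltnW js) => /(_ isT).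
  by rewrite nth_rcons js -cats1 takel_cat // ltnW.
- by move: us; rewrite rcons_uniq => /andP[].
- by move=> G Gs; apply: cs; rewrite mem_rcons inE Gs orbT.
- by [].
have chs G : G \in hs -> #|G| = d.+1.
  by move=> /shs Gs; apply: cs; rewrite mem_rcons inE Gs orbT.
(* The postponed facets have [d + 1] vertices and [F :\ v] has only [d], so it cannot be one of
   them. *)
have small v : v \in F -> (F :\ v)%SET \in complex_of s -> (F :\ v)%SET \in A.
  move=> vF; rewrite AE => /orP[//|/chs]; move: cF; rewrite (cardsD1 v) vF /=; lia.
have attF : forall G, G \in A -> exists v, [/\ v \in F, v \notin G & (F :\ v)%SET \in A].
  move=> G GA; have /in_complex_of[H Hs GH] : G \in complex_of s by rewrite AE GA.
  have /(_ _)/(_ H)[] := att (size s).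
  - by rewrite s_gt0 size_rcons ltnSn.
  - by rewrite tk.
  rewrite tk nth_rcons ltnn eqxx => v [vF vH vK].
  by exists v; split => //; [apply: contra vH; exact: (fintype.subsetP GH)|exact: small].
have Fhs : F \notin hs by apply: contra Fs; exact: shs.
have FA : F \notin A by apply: contra FK => FA; rewrite AE FA.
have [cl|/forallPn[w]] := boolP (closes s F).
  have bF v : v \in F -> (F :\ v)%SET \in A.
    by move=> vF; apply: small => //; move/forallP/(_ v): cl; rewrite vF.
  exists A, (rcons hs F); split => //.
  - split; first by rewrite rcons_uniq Fhs.
      move=> G; rewrite !mem_rcons !inE => /predU1P[->|/shs ->]; by rewrite ?eqxx ?orbT.
    by rewrite size_rcons numE nhs cl addn1.
  - by move=> G; rewrite mem_rcons inE => /predU1P[->|/homA].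
  - move=> G; rewrite KE mem_rcons inE AE.
    have [GF|GF] := boolP (G \subset F).
      have [_|GneF] := eqVneq G F; first by rewrite !orbT.
      move: GneF; rewrite finset.eqEsubset GF /= => /fintype.subsetPn[v vF vG].
      by rewrite (dA _ _ (bF _ vF)) // finset.subsetD1 GF.
    have -> : G == F = false by apply: contraNF GF => /eqP ->.
    by rewrite orbF.
rewrite negb_imply => /andP[wF wK].
exists (A :|: powerset F)%SET, hs; split.
- split => //; last by rewrite numE nhs (_ : closes s F = false) ?addn0 //;
    apply/negP => /forallP/(_ w); rewrite wF (negbTE wK).
  by move=> G /shs Gs; rewrite mem_rcons inE Gs orbT.
- by apply: down_closedU => //; exact: down_closed_powerset.
- by apply: (attach_contraction (w := w)) => //; apply: contra wK => wA; rewrite AE wA.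
- move=> G Ghs; have [GA GbA] := homA G Ghs; split.
    rewrite finset.in_setU negb_or GA powersetE; apply/negP => GF.
    have : G == F by rewrite eqEcard GF cF chs ?leqnn.
    by move=> /eqP GF'; move: Fhs; rewrite -GF' Ghs.
  by move=> v /GbA vA; rewrite finset.in_setU vA.
- by move=> G; rewrite KE AE finset.in_setU powersetE orbAC.
Qed.

Theorem shelling_wedge (R : realType) n d (sh : seq {set 'I_n}) :
  attaching sh -> uniq sh -> (forall F, F \in sh -> #|F| = d.+1) ->
  (0 < num_closing sh)%N ->
  homotopy_equivalent R (geometric_realization R (complex_of sh))
    (wedge_of_spheres R (num_closing sh) d).
Proof.
move=> att us cs num0.
have sh0 : (0 < size sh)%N by move: num0; rewrite /num_closing; case: (sh).
have [A [hs [[uhs shs nhs] dA hA homA AE]]] := attaching_cells R att us cs sh0.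
rewrite -nhs in num0 *.
apply: (@homotopy_equivalent_attached_cells _ _ _ _ A _ (fun i => nth finset.set0 hs i)) => //.
split => //.
- by move=> i j /eqP; rewrite nth_uniq // => /eqP/val_inj.
- move=> i; have iH := mem_nth finset.set0 (ltn_ord i); have [FA bF] := homA _ iH.
  by split => //; apply: cs; exact: shs.
- move=> G; rewrite AE; congr orb; apply/idP/existsP => [GH|[i /eqP ->]]; last exact: mem_nth.
  by have i := (index_mem G hs); rewrite GH in i; exists (Ordinal i); rewrite /= nth_index.
Qed.

(** * Powers of cycles *)

Section GraphPower.
Variables (T : finType) (e : rel T) (p : nat).

Lemma graph_powerP u v : reflect
  (u != v /\ exists s : seq T, [/\ (size s <= p)%N, path e u s, uniq (u :: s) & last u s = v])
  (graph_power e p u v).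
Proof.
apply: (iffP andP) => [[uv /existsP[l /existsP[s /and3P[es us /eqP ls]]]]|[uv [s [sp es us ls]]]].
  by split => //; exists s; split => //; rewrite size_tuple -ltnS.
split => //; have sl : (size s < p.+1)%N by [].
apply/existsP; exists (Ordinal sl); apply/existsP; exists (in_tuple s).
by rewrite es us ls eqxx.
Qed.

Lemma graph_power_sym : symmetric e -> symmetric (graph_power e p).
Proof.
move=> esym; suff imp u v : graph_power e p u v -> graph_power e p v u.
  by move=> u v; apply/idP/idP; exact: imp.
move=> /graph_powerP[uv [s [sp es us ls]]]; apply/graph_powerP; split; first by rewrite eq_sym.
exists (rev (belast u s)); split.
- by rewrite size_rev size_belast.
- by rewrite -ls rev_path (eq_path (e' := e)) // => x y; exact: esym.
- by rewrite -ls -rev_rcons -lastI rev_uniq.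
- by case: s ls {sp es us} => [|x s] /= ls; rewrite ?rev_cons ?last_rcons.
Qed.

End GraphPower.

Section ThreeSets.
Variables (T : finType) (e : rel T).
Hypothesis esym : symmetric e.

Let isolated (S : {set T}) x y : x \in S -> y \in S -> y != x ->
  (forall z, z \in S -> z != x -> ~~ e x z) -> ~~ e x x -> ~~ induced_connected e S.
Proof.
move=> xS yS yx iso xx; apply/negP => /forallP/(_ x); rewrite xS /= => /forallP/(_ y).
rewrite yS /= => /connectP[[|z s]] /= ; first by move=> _ E; move: yx; rewrite E eqxx.
case/andP => /and3P[_ zS exz] _ _; have [zx|zx] := eqVneq z x.
  by move: exz; rewrite zx (negbTE xx).
by move: exz; rewrite (negbTE (iso z zS zx)).
Qed.

(** With at most one edge among three vertices, some vertex is isolated. *)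
Lemma induced_connected3 a b c : irreflexive e -> a != b -> a != c -> b != c ->
  induced_connected e [set a; b; c]%SET =
    [|| e a b && e b c, e a b && e a c | e a c && e b c].
Proof.
move=> eirr ab ac bc; set S := [set a; b; c]%SET.
have aS : a \in S by rewrite !inE eqxx.
have bS : b \in S by rewrite !inE eqxx orbT.
have cS : c \in S by rewrite !inE eqxx !orbT.
apply/idP/idP => [|H].
  apply: contraLR; rewrite !negb_or !negb_and => H.
  have SE z : z \in S -> [\/ z = a, z = b | z = c].
    by rewrite !inE -orbA => /or3P[] /eqP; [constructor 1|constructor 2|constructor 3].
  have [eab|eab] := boolP (e a b).
    apply: (@isolated _ c a) => //; last by rewrite eirr.
    move=> z /SE[] ->; rewrite ?eqxx // esym; move: H; rewrite eab //=.
      by case/and3P.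
    by case/and3P.
  have [eac|eac] := boolP (e a c).
    apply: (@isolated _ b a) => //; last by rewrite eirr.
    move=> z /SE[] ->; rewrite ?eqxx //; first by rewrite esym.
    by move: H; rewrite eac //= => /and3P[].
  apply: (@isolated _ a b) => //; rewrite ?eirr // 1?eq_sym //.
  by move=> z /SE[] ->; rewrite ?eqxx.
have csym : connect_sym (induced e S).
  by apply: sym_connect_sym => x y; rewrite /induced /= (esym x y) andbCA.
have c1 x y : x \in S -> y \in S -> e x y -> connect (induced e S) x y.
  by move=> xS yS exy; apply: connect1; rewrite /induced /= xS yS.
have [cab cac] : connect (induced e S) a b /\ connect (induced e S) a c.
  case/or3P: H => /andP[e1 e2].
  - have h := c1 _ _ aS bS e1; split => //; apply: connect_trans h _; exact: c1.
  - by split; exact: c1.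
  - have h := c1 _ _ aS cS e1; split => //; apply: connect_trans h _.
    by rewrite csym; exact: c1.
have ca x : x \in S -> connect (induced e S) a x.
  by rewrite !inE -orbA => /or3P[] /eqP ->.
apply/forallP => x; apply/implyP => xS; apply/forallP => y; apply/implyP => yS.
by apply: connect_trans (ca y yS); rewrite csym; exact: ca.
Qed.

End ThreeSets.

Section CyclePower.
Variables (n p : nat).
Local Notation G := (graph_power (cycle_graph n) p).

Lemma ordSE (u : 'I_n) : nat_of_ord (ordS u) = if (u.+1 == n)%N then 0%N else u.+1.
Proof.
rewrite /=; case: eqP => [->|un]; first exact: modnn.
by rewrite modn_small // ltn_neqAle ltn_ord andbT; apply/eqP.
Qed.

Lemma cycle_graph_sym : symmetric (cycle_graph n).
Proof. by move=> u v; rewrite /cycle_graph /= orbC. Qed.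

Lemma graph_power_irr : irreflexive G.
Proof. by move=> u; rewrite /graph_power /= eqxx. Qed.

(** The cases are a displacement with offset 0, [-n] or [n]. Paths that wind further fall under the
    first, because they have at least [n] edges. *)
Let cycle_path_dist (u : 'I_n) s : path (cycle_graph n) u s ->
  [|| (last u s <= u + size s)%N && (u <= last u s + size s)%N,
      (u + n <= last u s + size s)%N | (last u s + n <= u + size s)%N].
Proof.
elim: s u => [|w s IH] u /=; first by rewrite !addn0 !leqnn.
move=> /andP[uw /IH]; have := ltn_ord u; have := ltn_ord w.
have := ltn_ord (last w s); case/orP: uw => /eqP/(congr1 (@nat_of_ord n));
  rewrite ordSE; case: eqP; lia.
Qed.

Let iter_ordS (u : 'I_n) j : nat_of_ord (iter j (@ordS n) u) = ((u + j) %% n)%N.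
Proof.
elim: j => [|j IH]; first by rewrite addn0 modn_small.
by rewrite iterS /= IH -addn1 modnDml addn1 addnS.
Qed.

Let power_iter_ordS (u : 'I_n) j : (0 < j < n)%N -> (j <= p)%N -> G u (iter j (@ordS n) u).
Proof.
move=> /andP[j0 jn] jp.
have inj i k : (i <= j)%N -> (k <= j)%N -> iter i (@ordS n) u = iter k (@ordS n) u -> i = k.
  move=> ij kj /(congr1 (@nat_of_ord n)); rewrite !iter_ordS => /eqP.
  rewrite eqn_modDl !modn_small; [by move/eqP|lia|lia].
apply/graph_powerP; split.
  by apply/eqP => E; have := inj 0%N j (leq0n _) (leqnn _) E; lia.
exists (traject (@ordS n) (ordS u) j); split.
- by rewrite size_traject.
- apply: sub_path (fpath_traject _ _ _) => x y /= /eqP <-.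
  by rewrite /cycle_graph /= eqxx.
- rewrite -[_ :: _]/(traject (@ordS n) u j.+1); apply/(uniqP u) => i k.
  rewrite !inE size_traject => ij kj; rewrite !nth_traject //.
  by apply: inj; rewrite -ltnS.
- by rewrite last_traject.
Qed.

Lemma cycle_power_adj (u v : 'I_n) : (u < v)%N ->
  G u v = (v <= u + p)%N || (u + n <= v + p)%N.
Proof.
move=> uv; have vn := ltn_ord v; apply/idP/orP.
  move=> /graph_powerP[_ [s [sp es _ ls]]]; have := cycle_path_dist es.
  by rewrite ls; have : (@size 'I_n s <= p)%N := sp; lia.
case=> h.
  have -> : v = iter (v - u) (@ordS n) u.
    by apply: ord_inj; rewrite iter_ordS subnKC ?modn_small // ltnW.
  by apply: power_iter_ordS; lia.
rewrite graph_power_sym; last exact: cycle_graph_sym.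
have -> : u = iter (u + n - v) (@ordS n) v.
  by apply: ord_inj; rewrite iter_ordS subnKC ?modnDr ?modn_small //; lia.
by apply: power_iter_ordS; lia.
Qed.

Definition gaps_ok (a b c : nat) : bool :=
  [|| (a + p < b)%N && (b + p < c)%N, (a + p < b)%N && (c + p < a + n)%N
    | (b + p < c)%N && (c + p < a + n)%N].

Lemma disconnected3 (a b c : 'I_n) : (a < b < c)%N ->
  ~~ induced_connected G [set a; b; c]%SET = gaps_ok a b c.
Proof.
move=> /andP[ab bc]; have cn := ltn_ord c.
rewrite induced_connected3; last 4 first.
- exact: graph_power_irr.
- by rewrite -val_eqE /= ltn_eqF.
- by rewrite -val_eqE /= ltn_eqF // (ltn_trans ab).
- by rewrite -val_eqE /= ltn_eqF.
- have ac := ltn_trans ab bc; rewrite !cycle_power_adj // /gaps_ok.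
  by apply/idP/idP; lia.
- by apply: graph_power_sym; exact: cycle_graph_sym.
Qed.

End CyclePower.

(** * The order on the cut triples *)

Section Order.
Variables (n p : nat).
Hypotheses (hp : (2 <= p)%N) (hn : (6 * p - 3 <= n)%N).
Local Open Scope nat_scope.

Definition cut_triple (a b c : nat) : bool :=
  [&& a < b, b < c, c < n & gaps_ok n p a b c].

(* These triples obstruct the naive order and are moved to the end. *)
Definition late (a b c : nat) : bool :=
  [&& n <= b + p, a + n <= b + 2 * p & c + p < a + n].

(** Among late triples the middle vertex increases, whereas it decreases among the others. A vertex
    strictly between [a] and [b] can then always replace [b] in a late triple: the result is either
    not late, or late with a smaller middle vertex. *)
Definition before (a b c a' b' c' : nat) : bool :=
  [|| ~~ late a b c && late a' b' c',
      late a b c && late a' b' c' &&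
        [|| a < a', (a == a') && (b < b') | [&& a == a', b == b' & c < c']]
    | ~~ late a b c && ~~ late a' b' c' &&
        [|| a < a', (a == a') && (b' < b) | [&& a == a', b == b' & c < c']]].

Let among (a b c v x : nat) : Prop := [\/ x = a, x = b, x = c | x = v].

(** Cut triples are listed increasingly and [before] is irreflexive, so the earlier triple cannot be
    [a, b, c] itself and must use [v]. *)
Definition exchange (a b c v : nat) : Prop := exists x y z,
  [/\ cut_triple x y z, before x y z a b c,
      among a b c v x, among a b c v y & among a b c v z].

Let exchangeI a b c v x y z : cut_triple x y z && before x y z a b c ->
  among a b c v x -> among a b c v y -> among a b c v z -> exchange a b c v.
Proof. by move=> /andP[h1 h2] h3 h4 h5; exists x, y, z; split. Qed.

Let am1 a b c v : among a b c v a. Proof. by constructor 1. Qed.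
Let am2 a b c v : among a b c v b. Proof. by constructor 2. Qed.
Let am3 a b c v : among a b c v c. Proof. by constructor 3. Qed.
Let am4 a b c v : among a b c v v. Proof. by constructor 4. Qed.

Ltac lin := unfold cut_triple, before, late, gaps_ok in *; lia.
Ltac exch x y z := apply: (@exchangeI _ _ _ _ x y z);
  [ | first [exact: am1|exact: am2|exact: am3|exact: am4] ..].

Lemma exchange_late a b c a' b' c' : late a b c ->
  cut_triple a b c -> cut_triple a' b' c' -> before a' b' c' a b c ->
  exists v, [/\ [|| v == a', v == b' | v == c'], [&& v != a, v != b & v != c]
    & exchange a b c v].
Proof.
move=> lt tS tS' bf.
have mid v : a < v < b -> exchange a b c v by move=> h; exch a v c; clear tS' bf; lin.
have [h|ha] := boolP (a < a' < b).
  by exists a'; split; [lia|lin|exact: mid].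
have [h|hb] := boolP (a < b' < b).
  by exists b'; split; [lia|lin|exact: mid].
have [h|hc] := boolP (a < c' < b).
  by exists c'; split; [lia|lin|exact: mid].
have /and3P[l1 l2 l3] := lt.
have /and4P[ab bc cn _] := tS; have /and4P[ab' bc' cn' g'] := tS'.
have ab_far : a + p < b by clear -hp hn l2 bc cn; lia.
have [h|h] := ltnP a' a.
  (* All of [a', b', c'] lie on the arc from [b] through 0 to [a], which has at most [2 * p] steps.
     If [a'] were within [p] of both ends, it would be adjacent to [b'] and [c']. *)
  have far : (a' + p < a) || (b + p < a' + n).
    apply: contraT => nfar; move: g'; rewrite /gaps_ok.
    have [b'a|ab''] := leqP b' a; first have [c'a|ac'] := leqP c' a.
    - by clear -nfar b'a c'a ab' bc'; lia.
    - by clear -nfar b'a ac' hc ab' bc'; lia.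
    - by clear -nfar ab'' hb l1 bc' cn'; lia.
  exists a'; split; [by rewrite eqxx|by clear -h ab bc; lia|].
  exch a' a b; clear -h far ab_far ab bc cn lt.
  by rewrite /before lt /= /cut_triple /late /gaps_ok; lia.
(* Otherwise [a' >= b], and the earlier triple would lie among the at most [p] vertices from [b] to
   [n - 1]. *)
have aE : a' = a.
  apply/eqP; apply: contraT => na; move: g'; rewrite /gaps_ok.
  by clear -na h ha l1 ab' bc' cn'; lia.
have bb' : b <= b' by clear -aE hb ab'; lia.
have lt' : late a' b' c'.
  by move: g'; rewrite /late /gaps_ok; clear -aE bb' l1 l2 bc' cn'; lia.
have [bE c'c] : b' = b /\ c' < c.
  by move: bf; rewrite /before lt lt' /=; clear -aE bb'; lia.
exists c'; split; [by rewrite eqxx !orbT|by clear -ab bc' bE c'c; lia|].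
by exch a b c'; rewrite -bE -aE tS' /= {}bE {}aE in bf *.
Qed.

Lemma exchange_early a b c a' b' c' : ~~ late a b c ->
  cut_triple a b c -> cut_triple a' b' c' -> before a' b' c' a b c ->
  exists v, [/\ [|| v == a', v == b' | v == c'], [&& v != a, v != b & v != c]
    & exchange a b c v].
Proof.
move=> lt tS tS' bf.
have [a'a|aa'] := ltnP a' a.
  have [h1|h1] := ltnP (c + p) (a' + n).
    by exists a'; split; [lia|lin|exch a' a c; clear tS' bf; lin].
  (* Non-lateness is used when [c <= b + p]. If [b >= n - p], the arc from [b] through 0 to [a] has
     more than [2 * p] steps, so [a'] is far from one of its ends; otherwise [b] itself is far from
     [a']. *)
  have [h2|h2] := leqP c (b + p).
    by exists a'; split; [lia|lin|exch a' a b; clear tS' bf; lin].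
  have [h3|h3] := ltnP (a' + p) b.
    by exists a'; split; [lia|lin|exch a' b c; clear tS' bf; lin].
  (* From here on [a' < a < b <= a' + p], and [c] is within [p] of [a'] across 0. Hence the gaps
     from [b] to [c] and from [c] to [a] exceed [p], and the arc from [a] to [c] has more than
     [2 * p] steps. *)
  have [h4|h4] := leqP c c'.
    by exists b'; split; [lia|lin|exch a b' c; clear bf; lin].
  have [h5|h5] := ltnP (b + p) c'.
    by exists c'; split; [lia|lin|exch a b c'; clear bf; lin].
  by exists c'; split; [lia|lin|exch a c' c; clear bf; lin].
have {bf aa'}[lt' [aE bf]] : ~~ late a' b' c' /\ a' = a /\ (b < b') || (b' == b) && (c' < c).
  by move: bf lt aa'; clear; rewrite /before; lia.
subst a'.
have [bb|bb] := leqP b' b.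
  by exists c'; split; [lia|lin|exch a b c'; clear tS; lin].
have [h1|h1] := ltnP b' c; last first.
  have [h2|h2] := eqVneq b' c; first by exists c'; split; [lia|lin|exch a c c'; lin].
  by exists b'; split; [lia|lin|exch a c b'; lin].
have [h2|h2] := ltnP (c + p) (a + n).
  have [h3|h3] := boolP ((b' <= a + p) && (c <= b' + p)).
    by exists c'; split; [lia|lin|exch a c c'; lin].
  by exists b'; split; [lia|lin|exch a b' c; lin].
have [h3|h3] := leqP c (b' + p).
  by exists b'; split; [lia|lin|exch a b b'; lin].
by exists b'; split; [lia|lin|exch a b' c; lin].
Qed.

Definition closing (a b c : nat) : bool :=
  [&& b == a.+1, a + 2 * p < c & (2 * p <= a.+1) || (c + 2 * p < a + n)].

Lemma closing_exchange a b c v : cut_triple a b c -> closing a b c ->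
  v < n -> [&& v != a, v != b & v != c] -> exchange a b c v.
Proof.
rewrite /closing => tS /and3P[/eqP bE h1 h2] vn vS; subst b.
have [va|av] := ltnP v a.
  have [h|h] := ltnP (c + p) (v + n); first by exch v a c; lin.
  (* Here [v <= c + p - n]. The first alternative of [h2] gives [v < p <= a + 1 - p], the second
     [v + p <= c + 2 * p - n < a]. *)
  have h' : v + p < a.+1 by clear -h h2 va tS; lin.
  by exch v a.+1 c; lin.
have [vc|cv] := ltnP v c; last by exch a c v; lin.
have [h|h] := boolP (late a v c); last by exch a v c; lin.
by exch a a.+1 v; lin.
Qed.

Ltac sorted ab bc := let xy := fresh in let yz := fresh in
  move=> /andP[/and4P[xy yz ? ?] ?];
  solve [clear -xy yz ab bc; lia | lin].

Lemma not_closing_exchange a b c : cut_triple a b c -> ~~ closing a b c ->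
  exists v, [/\ v < n, [&& v != a, v != b & v != c] & ~ exchange a b c v].
Proof.
move=> tS ncl; have /and4P[ab bc cn _] := tS.
have nex v : v < n -> [&& v != a, v != b & v != c] ->
    (forall x y z, among a b c v x -> among a b c v y -> among a b c v z ->
      cut_triple x y z && before x y z a b c -> False) ->
  exists v, [/\ v < n, [&& v != a, v != b & v != c] & ~ exchange a b c v].
  move=> vn vS H; exists v; split => // -[x [y [z [h1 h2 h3 h4 h5]]]].
  by apply: (H x y z) => //; rewrite h1.
have [lt|lt] := boolP (late a b c).
  (* This vertex is within [p] of [a], [b] and [c], so no cut triple contains it together with two
     of them. *)
  by apply: (nex (b + p - n)); [lin|lin|move=> x y z [] -> [] -> [] ->; sorted ab bc].
have [ab1|ab1] := ltnP a.+1 b.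
  (* A triple using [a + 1] either starts there or keeps [a] with the smaller middle vertex [a + 1];
     both come later. *)
  by apply: (nex a.+1); [lin|lin|move=> x y z [] -> [] -> [] ->; sorted ab bc].
have bE : b = a.+1 by lin.
subst b; rewrite /closing in ncl.
have [h1|h1] := leqP c (a + 2 * p).
  (* This vertex is within [p] of [a] and of [c], so a cut triple using it would start at
     [a + 1]. *)
  by apply: (nex (a + p)); [lin|lin|move=> x y z [] -> [] -> [] ->; sorted ab bc].
(* Now [c >= a + n - 2 * p]. For [a < p] the vertex [a + n - p] exists and is within [p] of [a] and
   of [c]. *)
have [h2|h2] := ltnP a p.
  by apply: (nex (a + n - p)); [lin|lin|move=> x y z [] -> [] -> [] ->; sorted ab bc].
(* The dangerous triple is [(a, c, c + 1)], with its larger middle vertex. Since [a >= p] gives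
   [c >= n - p], it is late whenever it is a cut triple. *)
have [h3|h3] := ltnP c.+1 n.
  by apply: (nex c.+1); [lin|lin|move=> x y z [] -> [] -> [] ->; sorted ab bc].
(* Now [c = n - 1] and [a + 2 <= 2 * p], so [a + 1 - p] is within [p] of all three vertices. *)
by apply: (nex (a.+1 - p)); [lin|lin|move=> x y z [] -> [] -> [] ->; sorted ab bc].
Qed.
End Order.

(** * The shelling of the cut complex and the number of spheres *)

Section CutSequence.
Variables (n p : nat).
Hypotheses (hp : (2 <= p)%N) (hn : (6 * p - 3 <= n)%N).
Local Open Scope nat_scope.
Local Notation triple := ('I_n * 'I_n * 'I_n)%type.
Implicit Types (t : triple) (v : 'I_n).
Local Notation G := (graph_power (cycle_graph n) p).

Let cut t := cut_triple n p t.1.1 t.1.2 t.2.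
Let bef t t' := before n p t.1.1 t.1.2 t.2 t'.1.1 t'.1.2 t'.2.
Let le_triple t t' := (t == t') || bef t t'.

Let tripleE t t' : t.1.1 = t'.1.1 :> nat -> t.1.2 = t'.1.2 :> nat -> t.2 = t'.2 :> nat -> t = t'.
Proof.
case: t => [[a b] c]; case: t' => [[a' b'] c'] /= h1 h2 h3.
by rewrite (ord_inj h1) (ord_inj h2) (ord_inj h3).
Qed.

Let bef_irr t : bef t t = false.
Proof. by rewrite /bef /before; lia. Qed.

Let bef_asym t t' : bef t t' -> bef t' t -> False.
Proof.
rewrite /bef /before; case: (late _ _ t.1.1 _ _); case: (late _ _ _ _ _) => /=; lia.
Qed.

Let bef_trans t' t t'' : bef t t' -> bef t' t'' -> bef t t''.
Proof.
rewrite /bef /before.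
move: (late n p t.1.1 _ _) (late n p t'.1.1 _ _) (late n p t''.1.1 _ _).
by move=> [] [] [] /=; lia.
Qed.

Let bef_total t t' : t != t' -> bef t t' || bef t' t.
Proof.
move=> tt'; rewrite /bef /before.
have : [|| t.1.1 != t'.1.1 :> nat, t.1.2 != t'.1.2 :> nat | t.2 != t'.2 :> nat].
  by rewrite -!negb_and; apply: contra tt' => /and3P[/eqP ? /eqP ? /eqP ?]; apply/eqP/tripleE.
move: (late n p t.1.1 _ _) (late n p t'.1.1 _ _) => [] [] /=; lia.
Qed.

Let le_total : total le_triple.
Proof.
move=> t t'; rewrite /le_triple (eq_sym t').
by have [//|tt'] := eqVneq t t'; exact: bef_total.
Qed.

Let le_trans : transitive le_triple.
Proof.
move=> t' t t''; rewrite /le_triple => /predU1P[->//|h] /predU1P[<-|h'].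
  by rewrite h orbT.
by rewrite (bef_trans h h') orbT.
Qed.

Definition cut_seq : seq triple := sort le_triple [seq t <- enum {: triple} | cut t].

Definition triple_set t : {set 'I_n} := [set t.1.1; t.1.2; t.2]%SET.
Definition facet t : {set 'I_n} := (~: triple_set t)%SET.

Let mem_cut_seq t : (t \in cut_seq) = cut t.
Proof. by rewrite mem_sort mem_filter mem_enum andbT. Qed.

Let uniq_cut_seq : uniq cut_seq.
Proof. by rewrite sort_uniq filter_uniq // enum_uniq. Qed.

Let nth_bef t0 i j : i < j < size cut_seq -> bef (nth t0 cut_seq i) (nth t0 cut_seq j).
Proof.
move=> /andP[ij js]; have is_ := ltn_trans ij js.
have := @sorted_ltn_nth _ _ le_trans t0 cut_seq (sort_sorted le_total _) i j is_ js ij.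
by rewrite /le_triple nth_uniq // (ltn_eqF ij).
Qed.

Let mem_take_cut t0 j t : j < size cut_seq ->
  (t \in take j cut_seq) = cut t && bef t (nth t0 cut_seq j).
Proof.
move=> js; rewrite -mem_cut_seq; apply/idP/andP => [tj|[tL tb]].
  have tL := mem_take tj; split => //.
  have ij : index t cut_seq < j by rewrite -in_take // tL.
  by rewrite -{1}(nth_index t0 tL); apply: nth_bef; rewrite ij.
rewrite in_take // ltnNge; apply/negP => ji.
have E := nth_index t0 tL; move: ji; rewrite leq_eqVlt => /predU1P[jE|ji].
  by move: tb; rewrite jE E bef_irr.
have := @nth_bef t0 j (index t cut_seq); rewrite ji index_mem tL E => /(_ isT).
by move=> h; exact: bef_asym tb h.
Qed.

Let in_triple t v :
  (v \in triple_set t) = [|| v == t.1.1 :> nat, v == t.1.2 :> nat | v == t.2 :> nat].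
Proof. by rewrite !inE -orbA -!val_eqE. Qed.

Let sub_triple t (S : {set 'I_n}) :
  (triple_set t \subset S) = [&& t.1.1 \in S, t.1.2 \in S & t.2 \in S].
Proof. by rewrite !finset.subUset !finset.sub1set andbA. Qed.

Let triple_set_inj t t' : cut t -> cut t' -> triple_set t \subset triple_set t' -> t = t'.
Proof.
rewrite sub_triple !in_triple /cut /cut_triple => ct ct' h.
by apply: tripleE; clear -ct ct' h; lia.
Qed.

Let card_triple t : cut t -> #|triple_set t| = 3.
Proof.
rewrite /cut /cut_triple => ct; rewrite /triple_set finset.setUC cardsU1 cards2 !inE -!val_eqE /=.
by clear -ct; lia.
Qed.

Lemma set3_triple (S : {set 'I_n}) : #|S| = 3 ->
  exists t, [/\ t.1.1 < t.1.2, t.1.2 < t.2 & S = triple_set t].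
Proof.
move=> cS.
have [x xS] : exists x, x \in S by apply/card_gt0P; rewrite cS.
move: cS; rewrite (cardsD1 x) xS => -[] /eqP/cards2P[y [z [yz E]]].
have [xy xz] : x != y /\ x != z.
  by split; apply/eqP => h; have := setD11 x S; rewrite E !inE h eqxx ?orbT.
have {E}SE w : (w \in S) = [|| w == x, w == y | w == z].
  have := in_setD1 w S x; rewrite E !inE; have [->|wx] /= := eqVneq w x.
    by rewrite xS.
  by move=> <-.
have mk (a b c : 'I_n) : a < b -> b < c -> perm_eq [:: a; b; c] [:: x; y; z] ->
    exists t, [/\ t.1.1 < t.1.2, t.1.2 < t.2 & S = triple_set t].
  move=> ab bc /perm_mem pm; exists (a, b, c); split => //=; apply/setP => w.
  by rewrite SE /triple_set !inE -orbA; have := pm w; rewrite !inE.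
rewrite -!val_eqE /= in xy xz yz.
have [h1|h1] := ltnP x y; have [h2|h2] := ltnP y z; have [h3|h3] := ltnP x z.
- exact: (mk x y z).
- by exfalso; lia.
- apply: (mk x z y) => //; first by lia.
  by rewrite /= perm_cons; apply/permP => q /=; lia.
- apply: (mk z x y) => //; first by lia.
  by apply/permP => q /=; lia.
- apply: (mk y x z) => //; first by lia.
  by apply/permP => q /=; lia.
- apply: (mk y z x) => //; first by lia.
  by apply/permP => q /=; lia.
- by exfalso; lia.
- apply: (mk z y x); [lia|lia|].
  by apply/permP => q /=; lia.
Qed.

Definition cut_shelling : seq {set 'I_n} := [seq facet t | t <- cut_seq].

Let card_facet t : cut t -> #|facet t| = (n - 4).+1.
Proof.
by move=> ct; have := cardsC (triple_set t); rewrite card_triple // card_ord /facet; lia.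
Qed.

Let mem_cut_shelling F :
  (F \in cut_shelling) = (#|F| + 3 == #|'I_n|) && ~~ induced_connected G (~: F)%SET.
Proof.
apply/mapP/andP => [[t]|[/eqP cF dF]].
  rewrite mem_cut_seq => ct ->; rewrite card_facet // card_ord /facet finset.setCK.
  split; first by apply/eqP; lia.
  by rewrite disconnected3; move: ct; rewrite /cut /cut_triple => /and4P[? ? ? ?] //; apply/andP.
have [|t [h1 h2 tE]] := @set3_triple (~: F)%SET.
  by have := cardsC F; rewrite -cF; lia.
exists t; last by rewrite /facet -tE finset.setCK.
rewrite mem_cut_seq /cut /cut_triple h1 h2 ltn_ord /=.
by rewrite -disconnected3 ?h1 // -/(triple_set t) -tE.
Qed.

Lemma complex_of_cut_shelling : complex_of cut_shelling = cut_complex G 3.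
Proof.
apply/setP => S; apply/in_complex_of/finset.bigcupP => [[F]|[F]].
  by rewrite mem_cut_shelling => hF SF; exists F; rewrite ?inE ?powersetE.
by rewrite inE powersetE -mem_cut_shelling => hF SF; exists F.
Qed.

Lemma uniq_cut_shelling : uniq cut_shelling.
Proof.
rewrite map_inj_in_uniq // => t t'; rewrite !mem_cut_seq => ct ct' /finset.setC_inj E.
by apply: triple_set_inj => //; rewrite E.
Qed.

Lemma card_cut_shelling F : F \in cut_shelling -> #|F| = (n - 4).+1.
Proof. by case/mapP => t; rewrite mem_cut_seq => /card_facet ? ->. Qed.

Lemma facets_cut_shelling : perm_eq cut_shelling (enum (facets (cut_complex G 3))).
Proof.
apply: uniq_perm; [exact: uniq_cut_shelling|exact: enum_uniq|] => F.
rewrite mem_enum inE -complex_of_cut_shelling; apply/idP/andP.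
  move=> FL; split; first by apply/in_complex_of; exists F.
  apply/forallP => S; apply/implyP => /in_complex_of[H HL SH]; apply/implyP => FS.
  rewrite finset.eqEsubset FS andbT; apply: (fintype.subset_trans SH).
  have /eqP -> // : F == H.
  by rewrite eqEcard (fintype.subset_trans FS SH) !card_cut_shelling // leqnn.
move=> [/in_complex_of[H HL FH] /forallP/(_ H)].
have -> : H \in complex_of cut_shelling by apply/in_complex_of; exists H.
by rewrite FH /= => /eqP <-.
Qed.

Let take_cut_shelling j : take j cut_shelling = [seq facet t | t <- take j cut_seq].
Proof. by rewrite /cut_shelling map_take. Qed.

(* Passing to complements, removing v from a facet and staying in an earlier
   facet is an exchange of v into the triple. *)
Let facet_exchange t0 j v (t := nth t0 cut_seq j) : j < size cut_seq -> v \notin triple_set t ->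
  reflect (exchange n p t.1.1 t.1.2 t.2 v)
    ((facet t :\ v)%SET \in complex_of (take j cut_shelling)).
Proof.
move=> js vt; rewrite take_cut_shelling.
have subE t' : (facet t :\ v \subset facet t')%SET = (triple_set t' \subset v |: triple_set t)%SET.
  by rewrite -finset.setCS /facet finset.setCK finset.setCD finset.setCK finset.setUC.
apply: (iffP idP) => [/in_complex_of[_ /mapP[t' + ->]]|].
  rewrite (mem_take_cut t0) // subE => /andP[ct' bt'].
  rewrite sub_triple !finset.in_setU1 !in_triple -!val_eqE => /and3P[h1 h2 h3].
  have am (x : nat) : [|| x == v, x == t.1.1, x == t.1.2 | x == t.2] ->
      [\/ x = t.1.1, x = t.1.2, x = t.2 | x = v].
    by case/or4P => /eqP; [constructor 4|constructor 1|constructor 2|constructor 3].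
  by exists t'.1.1, t'.1.2, t'.2; split => //; exact: am.
move=> [x [y [z [cxyz bxyz hx hy hz]]]].
have [xn yn zn] : [/\ x < n, y < n & z < n].
  by move: cxyz; rewrite /cut_triple; clear; split; lia.
pose t' : triple := (Ordinal xn, Ordinal yn, Ordinal zn).
apply/in_complex_of; exists (facet t').
  by apply/mapP; exists t' => //; rewrite (mem_take_cut t0) //; apply/andP.
rewrite subE sub_triple !finset.in_setU1 !in_triple -!val_eqE /=.
by apply/and3P; split; [case: hx|case: hy|case: hz] => ->; rewrite eqxx ?orbT.
Qed.

Let notin_triple t v : (v \notin triple_set t) =
  [&& v != t.1.1 :> nat, v != t.1.2 :> nat & v != t.2 :> nat].
Proof. by rewrite in_triple !negb_or. Qed.

Lemma attaching_cut_shelling : attaching cut_shelling.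
Proof.
move=> j; rewrite size_map => /andP[_ js] F; rewrite {1}take_cut_shelling => /mapP[t' + ->].
have t0 := t'; rewrite (nth_map t0) // (mem_take_cut t0) // => /andP[ct' bt'].
set t := nth t0 cut_seq j in bt' *.
have ct : cut t by rewrite -mem_cut_seq mem_nth.
have [v [vt' vt ex]] : exists v : nat, [/\ [|| v == t'.1.1, v == t'.1.2 | v == t'.2],
    [&& v != t.1.1, v != t.1.2 & v != t.2]
    & exchange n p t.1.1 t.1.2 t.2 v].
  have [lt|lt] := boolP (late n p t.1.1 t.1.2 t.2).
    exact: (exchange_late hp hn lt ct ct' bt').
  exact: (exchange_early hp hn lt ct ct' bt').
have vn : v < n by case/or3P: vt' => /eqP ->.
exists (Ordinal vn); split.
- by rewrite finset.in_setC notin_triple.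
- by rewrite finset.in_setC negbK in_triple.
- by apply/facet_exchange => //; rewrite notin_triple.
Qed.

Let closing3 t := closing n p t.1.1 t.1.2 t.2.

Let closes_cut_shelling t0 j : j < size cut_seq ->
  closes (take j cut_shelling) (nth finset.set0 cut_shelling j) = closing3 (nth t0 cut_seq j).
Proof.
move=> js; rewrite (nth_map t0) //; set t := nth t0 cut_seq j.
have ct : cut t by rewrite -mem_cut_seq mem_nth.
apply/forallP/idP => [h|cl v].
  apply: contraT => /(not_closing_exchange hp hn ct)[v [vn vt []]].
  have vt' : Ordinal vn \notin triple_set t by rewrite notin_triple.
  apply/(facet_exchange js vt').
  by have := h (Ordinal vn); rewrite finset.in_setC vt'.
rewrite finset.in_setC; apply/implyP => vt; apply/facet_exchange => //.
by apply: closing_exchange => //; rewrite -notin_triple.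
Qed.

Let num_closing_card :
  num_closing cut_shelling = #|[set t : triple | cut t && closing3 t]%SET|.
Proof.
rewrite /num_closing size_map.
case: (posnP (size cut_seq)) => [s0|s_gt0].
  rewrite s0 /=; apply/esym/eqP; rewrite cards_eq0; apply/eqP/setP => t.
  rewrite !inE; apply/negbTE; rewrite -mem_cut_seq.
  by move/size0nil: s0 => ->.
have t0 : triple by case: cut_seq s_gt0.
transitivity (count closing3 cut_seq).
  have := map_nth_iota0 t0 (leqnn (size cut_seq)); rewrite take_size => E.
  rewrite -[in RHS]E count_map.
  apply: eq_in_count => j; rewrite mem_iota => /andP[_ js] /=.
  exact: closes_cut_shelling.
rewrite /cut_seq (permP (permEl (perm_sort _ _))) count_filter cardE enumT.
rewrite -size_filter; congr size; rewrite /enum_mem -enumT.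
by apply: eq_filter => t; rewrite !inE andbC.
Qed.

Let sum_interval (l u m : nat) : \sum_(i < m) ((l <= i) && (i < u)) = minn m u - l.
Proof. by elim: m => [|m IH]; [rewrite big_ord0; lia|rewrite big_ord_recr /= IH; lia]. Qed.

Let sum_descending (k m : nat) : k <= m -> \sum_(i < m) (k - i) = 'C(k.+1, 2).
Proof.
elim: k m => [|k IH] m; first by move=> _; rewrite big1.
case: m => // m km; rewrite big_ord_recl /= subn0.
under eq_bigr => i _ do rewrite /bump /= add1n subSS.
by rewrite IH // [RHS]binS bin1 addnC.
Qed.

Let bin2_double m : 2 * 'C(m.+1, 2) = m.+1 * m.
Proof. by rewrite -mul_bin_diag bin1. Qed.

(** Since [b = a + 1], only pairs [(a, c)] are counted. Each of the [2p - 1] values [a < 2p - 1]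
    contributes [n - 4p - 1]; the others contribute [n - 2p - 1 - a], which adds up to the binomial
    coefficient of [n - 4p + 1] over 2. *)
Lemma num_closing_cut_shelling :
  num_closing cut_shelling = 'C(n - 2 * p, 2) - (2 * p ^ 2 + p - 1).
Proof.
pose Q (a c : nat) := (a + 2 * p < c) && ((2 * p <= a.+1) || (c + 2 * p < a + n)).
rewrite num_closing_card.
have -> : #|[set t : triple | cut t && closing3 t]%SET| = #|[set z : 'I_n * 'I_n | Q z.1 z.2]%SET|.
  pose f (t : triple) := (t.1.1, t.2).
  rewrite -(@card_in_imset _ _ f) => [|t t'].
    apply: eq_card => -[a c]; rewrite inE /=; apply/imsetP/idP => [[t]|Qac].
      by rewrite inE => /andP[_ /and3P[_ h1 h2]] [-> ->]; rewrite /Q h1 h2.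
    have an : a.+1 < n by have := ltn_ord c; move: Qac; rewrite /Q; clear; lia.
    exists (a, Ordinal an, c) => //; rewrite inE /cut /closing3 /closing /= eqxx /=.
    have cn := ltn_ord c; rewrite -/(Q a c) Qac andbT.
    by move: Qac; rewrite /cut_triple /gaps_ok /Q /=; clear -hp hn cn; lia.
  rewrite !inE => /andP[_ /and3P[/eqP b1 _ _]] /andP[_ /and3P[/eqP b2 _ _]] [h1 h2].
  by apply: tripleE; rewrite ?b1 ?b2 ?h1 ?h2.
have -> : #|[set z : 'I_n * 'I_n | Q z.1 z.2]%SET| = \sum_(a < n) \sum_(c < n) Q a c.
  rewrite pair_big /= -sum1dep_card big_mkcond /=.
  by apply: eq_bigr => z _; case: (Q _ _).
have rowE (a : 'I_n) : \sum_(c < n) Q a c =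
    if 2 * p <= a.+1 then (n - 2 * p).-1 - a else n - (4 * p).+1.
  have an := ltn_ord a; case: ifP => h.
    rewrite -[RHS](_ : minn n n - (a + 2 * p).+1 = _); last by clear -h an; lia.
    rewrite -sum_interval; apply: eq_bigr => c _; congr nat_of_bool.
    by rewrite /Q h /= ltn_ord.
  rewrite -[RHS](_ : minn n (a + n - 2 * p) - (a + 2 * p).+1 = _); last by clear -h an hp hn; lia.
  rewrite -sum_interval; apply: eq_bigr => c _; congr nat_of_bool.
  by rewrite /Q h /=; clear -h an hp hn; lia.
rewrite (eq_bigr _ (fun a _ => rowE a)).
rewrite -(big_mkord xpredT (fun a => if 2 * p <= a.+1 then (n - 2 * p).-1 - a else n - (4 * p).+1)).
rewrite (@big_cat_nat _ _ _ (2 * p).-1) //=; last by clear -hp hn; lia.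
rewrite (eq_big_nat _ _ (F2 := fun=> n - (4 * p).+1)) => [|a /andP[_ h]]; last first.
  by rewrite ifF //; clear -h hp; lia.
rewrite sum_nat_const_nat subn0.
rewrite (eq_big_nat _ _ (F2 := fun a => (n - 2 * p).-1 - a)) => [|a /andP[h _]]; last first.
  by rewrite ifT //; clear -h hp; lia.
rewrite [X in _ + X](_ : _ = \sum_(i < n - (2 * p).-1) (n - 4 * p - i)); last first.
  rewrite -{1}[(2 * p).-1]add0n big_addn big_mkord; apply: eq_bigr => i _.
  by clear -hp hn; lia.
rewrite sum_descending; last by clear -hp hn; lia.
have [k nE] : exists k, n = 4 * p + 1 + k by exists (n - (4 * p + 1)); clear -hp hn; lia.
rewrite nE.
have -> : 4 * p + 1 + k - (4 * p).+1 = k by lia.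
have -> : (4 * p + 1 + k - 4 * p).+1 = k.+2 by lia.
have -> : 4 * p + 1 + k - 2 * p = (2 * p + k).+1 by lia.
have := bin2_double k.+1; have := bin2_double (2 * p + k).
have -> : p = p.-1.+1 by clear -hp; lia.
have -> : (2 * p.-1.+1).-1 = 2 * p.-1 + 1 by lia.
by rewrite -!mulnn; clear; lia.
Qed.

Lemma num_closing_gt0 : 0 < num_closing cut_shelling.
Proof.
rewrite num_closing_cut_shelling.
have [k nE] : exists k, n = 4 * p + 1 + k by exists (n - (4 * p + 1)); clear -hp hn; lia.
have -> : n - 2 * p = (2 * p + k).+1 by lia.
have := bin2_double (2 * p + k).
(* The bound [n >= 6 * p - 3] says that [k + 4 >= 2 * p]. In terms of [q = p - 2] and [l] the claim
   becomes a polynomial inequality over natural numbers, free of truncated subtraction in its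
   parameters. *)
have [l kE] : exists l, k + 4 = 2 * p + l by exists (k + 4 - 2 * p); clear -nE hp hn; lia.
have [q pE] : exists q, p = q + 2 by exists (p - 2); clear -hp; lia.
have {kE}-> : k = 2 * q + l by clear -kE pE; lia.
by rewrite pE -!mulnn; clear; nia.
Qed.

End CutSequence.


Local Close Scope ring_scope.
Local Close Scope classical_set_scope.

Theorem theorem1p4 (R : realType) (p n : nat)
    (hp : (2 <= p)%N) (hn : (6 * p - 3 <= n)%N) :
  shellable (cut_complex (graph_power (cycle_graph n) p) 3) /\
  homotopy_equivalent R
    (geometric_realization R (cut_complex (graph_power (cycle_graph n) p) 3))
    (wedge_of_spheres R
      ('C(n - 2 * p, 2) - (2 * p ^ 2 + p - 1))%N (n - 4)%N).
Proof.
split.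
  exists (cut_shelling n p); split; first exact: facets_cut_shelling.
  exact/attaching_shelling/attaching_cut_shelling.
rewrite -num_closing_cut_shelling // -complex_of_cut_shelling //.
apply: shelling_wedge.
- exact: attaching_cut_shelling.
- exact: uniq_cut_shelling.
- by move=> F; exact: card_cut_shelling.
- exact: num_closing_gt0.
Qed.
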